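(* Let $n\ge 2$ and let $B_n$, $P_n$, $R_n$, $d_{n-1}$, the notion of topological triviality, and the braid $s(b)$ be as defined in the context. A pure braid $b\in P_n$ is topologically trivial (i.e. $b\in R_n$) if and only if the corresponding braid $s(b)$ is a power of the full twist of the first $n-1$ strands, i.e. $s(b)=\iota(d_{n-1}^{\,m})$ for some integer $m$. Moreover, topological equivalence classes of pure braids on $n$ strands (the elements of $P_n/R_n$) are in one-to-one correspondence, via $b\mapsto s(b)$, with the elements of $P_{n-1}/\langle d_{n-1}\rangle$, i.e. of the pure braid group on $n-1$ strands modulo its center.
   Context: $B_n$ is Artin's braid group with standard generators $\sigma_1,\dots,\sigma_{n-1}$ (relations $\sigma_i\sigma_{i+1}\sigma_i=\sigma_{i+1}\sigma_i\sigma_{i+1}$, and $\sigma_i\sigma_j=\sigma_j\sigma_i$ for $|i-j|>1$), and $P_n\subset B_n$ is the pure braid group, the kernel of the map to the symmetric group sending $\sigma_i$ to the transposition $(i\ i{+}1)$. The map $\iota:B_{n-1}\to B_n$, $\sigma_i\mapsto\sigma_i$, is the standard inclusion (adding a straight, unentangled $n$-th strand); a pure braid in $P_n$ is said to have its $n$-th strand running straight if it lies in $\iota(P_{n-1})$. Full twist: $d_n:=(\sigma_{n-1}\cdots\sigma_2\sigma_1)^n\in P_n$, with $d_1=1$; $d_{n-1}$ denotes the corresponding element of $P_{n-1}$. Flips: for $1\le i\le n$, $$r_i:=(\sigma_{i-1}\cdots\sigma_2\sigma_1)(\sigma_1\sigma_2\cdots\sigma_{n-1})(\sigma_{n-1}\sigma_{n-2}\cdots\sigma_i)\in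 P_n,$$ where the first factor is empty for $i=1$ and the last factor is empty for $i=n$. $R_n\subset P_n$ is the subgroup generated by $d_n,r_1,\dots,r_n$ (equivalently, by the elements $b_k=d_n(r_kr_{k-1}\cdots r_1)^{-1}$, $0\le k\le n$, which represent passing the common upper end of the braid between the first $k$ and the last $n-k$ strands); it is a normal subgroup of $B_n$. A pure braid $b\in P_n$ is called topologically trivial (it can be unplaited keeping separately its upper ends and its lower ends tied together) if $b\in R_n$; two pure braids are topologically equivalent if they have the same class in $P_n/R_n$. The braid $s(b)$: write $b\in P_n$ as a word $\sigma_{i_1}^{\pm1}\sigma_{i_2}^{\pm1}\cdots\sigma_{i_k}^{\pm1}$. Read the word from right to left, tracking the position of the strand which starts (at the right-hand end) at position $n$; each letter $\sigma_j^{\pm1}$ exchanges positions $j$ and $j+1$. Whenever the tracked strand is at position $i$ and the next letter is $\sigma_{i-1}$, insert $r_i^{-1}$ immediately to the left of that letter; whenever it is at position $i$ and the next letter is $\sigma_i^{-1}$, insert $r_i$ immediately to the left of that letter. (These are the letters at which the tracked strand passes in front of another one. Positions are tracked along the original word.) The braid represented by the resulting word is $s(b)$; it may depend on the chosen word for $b$, and the claim is for any choice of the word. The braid $s(b)$ lies in $\iota(P_{n-1})$ and is identified with an element of $P_{n-1}$ via $\iota$. *)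

(* Defs.v *)
From HB Require Import structures.
From mathcomp Require Import all_boot fingroup perm ssralg ssrint.
From mathcomp Require Import zify.
From mathcomp Require Import boolp classical_sets functions.

Set Implicit Arguments.
Unset Strict Implicit.
Unset Printing Implicit Defensive.

Local Open Scope group_scope.
Local Open Scope quotient_scope.
Local Open Scope classical_set_scope.

(* Positions and generators are numbered from 0: the letter (j, true) stands  *)
(* for the Artin generator sigma_{j+1}, exchanging the positions j and j+1    *)
(* (0-based), and (j, false) for its inverse.                                 *)
Definition letter (n : nat) := ('I_n.-1 * bool)%type.
Definition bword (n : nat) := seq (letter n).

Inductive braid_eq (n : nat) : bword n -> bword n -> Prop :=
| braid_eq_refl u : braid_eq u u
| braid_eq_sym u v : braid_eq u v -> braid_eq v u
| braid_eq_trans u v w : braid_eq u v -> braid_eq v w -> braid_eq u w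
| braid_eq_cat u u' v v' :
    braid_eq u u' -> braid_eq v v' -> braid_eq (u ++ v) (u' ++ v')
| braid_eq_cancel (j : 'I_n.-1) (e : bool) : braid_eq [:: (j, e); (j, ~~ e)] [::]
| braid_eq_braid (i j : 'I_n.-1) : j = i.+1 :> nat ->
    braid_eq [:: (i, true); (j, true); (i, true)]
             [:: (j, true); (i, true); (j, true)]
| braid_eq_far (i j : 'I_n.-1) : i.+1 < j ->
    braid_eq [:: (i, true); (j, true)] [:: (j, true); (i, true)].

Definition braid_eqb (n : nat) : rel (bword n) := fun u v => `[< braid_eq u v >].

Lemma braid_eqb_refl n : reflexive (@braid_eqb n).
Proof. by move=> u; apply/asboolP; exact: braid_eq_refl. Qed.

Lemma braid_eqb_sym n : symmetric (@braid_eqb n).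
Proof.
by move=> u v; apply/asboolP/asboolP => h; exact: braid_eq_sym h.
Qed.

Lemma braid_eqb_trans n : transitive (@braid_eqb n).
Proof.
move=> v u w /asboolP uv /asboolP vw; apply/asboolP.
exact: braid_eq_trans uv vw.
Qed.

Canonical braid_equiv (n : nat) :=
  EquivRel (@braid_eqb n) (@braid_eqb_refl n) (@braid_eqb_sym n)
    (@braid_eqb_trans n).

(* Artin's braid group B_n. *)
Definition braid (n : nat) := {eq_quot (@braid_equiv n)}.
HB.instance Definition _ n := Choice.on (braid n).
HB.instance Definition _ n := EqQuotient.on (braid n).

Local Notation qrepr := generic_quotient.repr.

Definition cls (n : nat) (w : bword n) : braid n := \pi_(braid n) w.

Lemma clsP n (u v : bword n) : cls u = cls v <-> braid_eq u v.
Proof.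
rewrite /cls; split=> [/eqP|h]; first by rewrite eqmodE => /asboolP.
by apply/eqP; rewrite eqmodE; apply/asboolP.
Qed.

Lemma cls_repr n (b : braid n) : cls (qrepr b) = b.
Proof. exact: reprK. Qed.

Definition inv_letter (n : nat) (l : letter n) : letter n := (l.1, ~~ l.2).
Definition inv_word (n : nat) (w : bword n) : bword n :=
  rev (map (@inv_letter n) w).

Lemma inv_letterK n : involutive (@inv_letter n).
Proof. by case=> j e; rewrite /inv_letter negbK. Qed.

Lemma inv_wordK n : involutive (@inv_word n).
Proof.
move=> w; rewrite /inv_word map_rev revK -map_comp.
by rewrite map_id_in // => l _; exact: inv_letterK.
Qed.

Lemma braid_eq_mulV n (w : bword n) : braid_eq (w ++ inv_word w) [::].
Proof.
elim: w => [|[j e] w IHw]; first exact: braid_eq_refl.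
have -> : ((j, e) :: w) ++ inv_word ((j, e) :: w) =
    [:: (j, e)] ++ (w ++ inv_word w) ++ [:: (j, ~~ e)].
  by rewrite /inv_word /= rev_cons -cats1 catA.
apply: (@braid_eq_trans _ _ ([:: (j, e)] ++ [::] ++ [:: (j, ~~ e)])).
  apply: braid_eq_cat; first exact: braid_eq_refl.
  by apply: braid_eq_cat; [exact: IHw | exact: braid_eq_refl].
exact: braid_eq_cancel.
Qed.

Lemma braid_eq_Vmul n (w : bword n) : braid_eq (inv_word w ++ w) [::].
Proof. by rewrite -{2}(inv_wordK w); exact: braid_eq_mulV. Qed.

Lemma braid_eq_inv n (u v : bword n) :
  braid_eq u v -> braid_eq (inv_word u) (inv_word v).
Proof.
move=> uv; apply: (@braid_eq_trans _ _ (inv_word u ++ (v ++ inv_word v))).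
  rewrite -{1}[inv_word u]cats0; apply: braid_eq_cat; first exact: braid_eq_refl.
  exact/braid_eq_sym/braid_eq_mulV.
rewrite catA -{2}[inv_word v]cat0s; apply: braid_eq_cat; last exact: braid_eq_refl.
apply: braid_eq_trans (braid_eq_Vmul u).
apply: braid_eq_cat; first exact: braid_eq_refl.
exact: braid_eq_sym.
Qed.

Definition braid_one (n : nat) : braid n := cls [::].
Definition braid_mul (n : nat) (a b : braid n) : braid n := cls (qrepr a ++ qrepr b).
Definition braid_inv (n : nat) (a : braid n) : braid n := cls (inv_word (qrepr a)).

Lemma braid_eq_repr n (w : bword n) : braid_eq (qrepr (cls w)) w.
Proof. by apply/clsP; rewrite cls_repr. Qed.

Lemma braid_mulE n (u v : bword n) : braid_mul (cls u) (cls v) = cls (u ++ v).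
Proof. by apply/clsP; apply: braid_eq_cat; exact: braid_eq_repr. Qed.

Lemma braid_invE n (u : bword n) : braid_inv (cls u) = cls (inv_word u).
Proof. by apply/clsP; apply: braid_eq_inv; exact: braid_eq_repr. Qed.

Lemma braid_mulA n : associative (@braid_mul n).
Proof.
move=> a b c; rewrite -(cls_repr a) -(cls_repr b) -(cls_repr c).
by rewrite !braid_mulE catA.
Qed.

Lemma braid_mul1 n : left_id (@braid_one n) (@braid_mul n).
Proof. by move=> a; rewrite -(cls_repr a) braid_mulE. Qed.

Lemma braid_mulr1 n : right_id (@braid_one n) (@braid_mul n).
Proof. by move=> a; rewrite -(cls_repr a) braid_mulE cats0. Qed.

Lemma braid_mulV n : left_inverse (@braid_one n) (@braid_inv n) (@braid_mul n).
Proof.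
move=> a; rewrite -(cls_repr a) braid_invE braid_mulE.
by apply/clsP; exact: braid_eq_Vmul.
Qed.

Lemma braid_mulrV n : right_inverse (@braid_one n) (@braid_inv n) (@braid_mul n).
Proof.
move=> a; rewrite -(cls_repr a) braid_invE braid_mulE.
by apply/clsP; exact: braid_eq_mulV.
Qed.

HB.instance Definition _ n := isGroup.Build (braid n)
  (@braid_mulA n) (@braid_mul1 n) (@braid_mulr1 n) (@braid_mulV n)
  (@braid_mulrV n).

Lemma clsM n (u v : bword n) : cls u * cls v = cls (u ++ v).
Proof. exact: braid_mulE. Qed.

Lemma clsV n (u : bword n) : (cls u)^-1 = cls (inv_word u).
Proof. exact: braid_invE. Qed.

Definition sigma (n : nat) (j : 'I_n.-1) : braid n := cls [:: (j, true)].

Definition eval (n : nat) (G : groupType) (f : 'I_n.-1 -> G) (w : bword n) : G :=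
  \prod_(l <- w) (if l.2 then f l.1 else (f l.1)^-1).

Definition braid_of (n : nat) (w : bword n) : braid n := eval (@sigma n) w.

Lemma eval_cat n (G : groupType) (f : 'I_n.-1 -> G) (u v : bword n) :
  eval f (u ++ v) = eval f u * eval f v.
Proof. by rewrite /eval big_cat. Qed.

Lemma braid_ofE n (w : bword n) : braid_of w = cls w.
Proof.
elim: w => [|[j e] w IHw]; first by rewrite /braid_of /eval big_nil.
rewrite /braid_of -cat1s eval_cat -/(braid_of w) IHw /eval big_seq1 /=.
rewrite -[cls (_ :: w)]/(cls ([:: (j, e)] ++ w)) -clsM.
by congr (_ * _); case: e => //; rewrite /sigma clsV.
Qed.

(* The presentation of B_n as a universal property. *)
Definition braid_rels (n : nat) (G : groupType) (f : 'I_n.-1 -> G) : Prop :=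
  (forall i j : 'I_n.-1, j = i.+1 :> nat -> f i * f j * f i = f j * f i * f j) /\
  (forall i j : 'I_n.-1, i.+1 < j -> f i * f j = f j * f i).

Definition braid_lift (n : nat) (G : groupType) (f : 'I_n.-1 -> G) (b : braid n) : G :=
  eval f (qrepr b).

Lemma eval_braid_eq n (G : groupType) (f : 'I_n.-1 -> G) (u v : bword n) :
  braid_rels f -> braid_eq u v -> eval f u = eval f v.
Proof.
move=> [fB fF]; elim=> {u v} // [u v w _ -> _ -> //|u u' v v' _ uE _ vE|j e|i j ij|i j ij].
- by rewrite !eval_cat uE vE.
- by rewrite /eval !big_cons !big_nil /= mulg1; case: e; rewrite /= ?mulgV ?mulVg.
- by rewrite /eval !big_cons !big_nil /= !mulg1 !mulgA fB.
- by rewrite /eval !big_cons !big_nil /= !mulg1 fF.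
Qed.

Lemma braid_lift_cls n (G : groupType) (f : 'I_n.-1 -> G) (w : bword n) :
  braid_rels f -> braid_lift f (cls w) = eval f w.
Proof. by move=> fR; apply: eval_braid_eq => //; exact: braid_eq_repr. Qed.

Lemma braid_liftM n (G : groupType) (f : 'I_n.-1 -> G) :
  braid_rels f -> {morph braid_lift f : a b / a * b}.
Proof.
move=> fR a b; rewrite -(cls_repr a) -(cls_repr b) clsM.
by rewrite !braid_lift_cls // eval_cat.
Qed.

Lemma braid_lift_sigma n (G : groupType) (f : 'I_n.-1 -> G) (j : 'I_n.-1) :
  braid_rels f -> braid_lift f (sigma j) = f j.
Proof. by move=> fR; rewrite braid_lift_cls // /eval big_seq1. Qed.

Lemma sigma_rels n : braid_rels (@sigma n).
Proof.
have M2 (k l : 'I_n.-1) : sigma k * sigma l = cls [:: (k, true); (l, true)].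
  exact: clsM.
split=> i j ij; rewrite !M2; last by apply/clsP; exact: braid_eq_far.
rewrite [sigma i]/sigma [sigma j]/sigma !(clsM [:: _; _]).
by apply/clsP; exact: braid_eq_braid.
Qed.

Definition subgroup (G : groupType) (H : set G) : Prop :=
  [/\ H 1, forall x y, H x -> H y -> H (x * y) & forall x, H x -> H x^-1].

Definition gen_subgroup (G : groupType) (X : set G) : set G :=
  smallest [set H | subgroup H] X.

Definition center (G : groupType) (H : set G) : set G :=
  [set x | H x /\ forall y, H y -> x * y = y * x].

Definition lcoset_set (G : groupType) (x : G) (K : set G) : set G :=
  [set x * y | y in K].

Definition quotient_set (G : groupType) (H K : set G) : set (set G) :=
  [set lcoset_set x K | x in H].

Definition expgz (G : groupType) (x : G) (m : int) : G :=
  match m with Posz k => x ^+ k | Negz k => x ^- k.+1 end.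

Lemma pos_lo_subproof (n : nat) (j : 'I_n.-1) : j < n.
Proof. exact: leq_trans (ltn_ord j) (leq_pred n). Qed.

Lemma pos_hi_subproof (n : nat) (j : 'I_n.-1) : j.+1 < n.
Proof. by case: n j => [[]|n] j //=; rewrite ltnS. Qed.

Definition pos_lo (n : nat) (j : 'I_n.-1) : 'I_n := Ordinal (pos_lo_subproof j).
Definition pos_hi (n : nat) (j : 'I_n.-1) : 'I_n := Ordinal (pos_hi_subproof j).

Definition adj_transp (n : nat) (j : 'I_n.-1) : 'S_n := tperm (pos_lo j) (pos_hi j).

(* The product of 'S_n composes from left to right; reversing it replaces     *)
(* braid_perm b by its inverse, so the kernel does not depend on it.          *)
Definition braid_perm (n : nat) : braid n -> 'S_n := braid_lift (@adj_transp n).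

Lemma adj_transp_rels n : braid_rels (@adj_transp n).
Proof.
have T3 (T : finType) (x y z : T) : x != y -> y != z -> x != z ->
    tperm x y * tperm y z * tperm x y = tperm y z * tperm x y * tperm y z.
  move=> xy yz xz.
  have -> : tperm x y * tperm y z * tperm x y = tperm y z ^ tperm x y.
    by rewrite /conjg tpermV mulgA.
  have -> : tperm y z * tperm x y * tperm y z = tperm x y ^ tperm y z.
    by rewrite /conjg tpermV mulgA.
  rewrite !tpermJ tpermL tpermR.
  by rewrite [tperm x y z]tpermD 1?[tperm y z x]tpermD // eq_sym.
split=> i j ij.
  rewrite /adj_transp.
  have E : pos_lo j = pos_hi i by apply: val_inj.
  by rewrite E; apply: T3; rewrite -val_eqE /= ?ij; lia.
rewrite /adj_transp conjgC tpermJ !tpermD // -val_eqE /=; lia.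
Qed.

Lemma braid_permM n : {morph @braid_perm n : a b / a * b}.
Proof. exact: braid_liftM (@adj_transp_rels n). Qed.

Lemma braid_perm_sigma n (j : 'I_n.-1) : braid_perm (sigma j) = adj_transp j.
Proof. exact: braid_lift_sigma (@adj_transp_rels n). Qed.

Definition pure_braid (n : nat) : set (braid n) := [set b | braid_perm b = 1].

Definition widen_gen (n : nat) (j : 'I_n.-1.-1) : 'I_n.-1 :=
  widen_ord (leq_pred n.-1) j.

Definition iota_braid (n : nat) : braid n.-1 -> braid n :=
  braid_lift (fun j => sigma (@widen_gen n j)).

Lemma iota_braid_rels n : braid_rels (fun j => sigma (@widen_gen n j)).
Proof. by split=> i j ij; [apply: (sigma_rels n).1 | apply: (sigma_rels n).2]. Qed.

Lemma iota_braidM n : {morph @iota_braid n : a b / a * b}.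
Proof. exact: braid_liftM (@iota_braid_rels n). Qed.

Lemma iota_braid_sigma n (j : 'I_n.-1.-1) :
  iota_braid (sigma j) = sigma (widen_gen j) :> braid n.
Proof. exact: braid_lift_sigma (@iota_braid_rels n). Qed.

Definition full_twist (n : nat) : braid n :=
  (\prod_(j <- rev (enum 'I_n.-1)) sigma j) ^+ n.

(* flip n p is the flip r_{p+1} of the strand at the 0-based position p.      *)
Definition flip (n : nat) (p : nat) : braid n :=
  (\prod_(j <- rev (enum 'I_n.-1) | j < p) sigma j) *
  (\prod_(j <- enum 'I_n.-1) sigma j) *
  (\prod_(j <- rev (enum 'I_n.-1) | p <= j) sigma j).

Definition trivial_subgroup (n : nat) : set (braid n) :=
  gen_subgroup [set b | b = full_twist n \/ exists2 p, p < n & b = flip n p].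

Definition topologically_trivial (n : nat) (b : braid n) : Prop :=
  trivial_subgroup b.

(* Words are read from right to left, so the head of a list is read last:     *)
(* tracked w is the 0-based position, after reading w, of the strand that     *)
(* starts at the last position.                                               *)
Fixpoint tracked (n : nat) (w : bword n) : nat :=
  match w with
  | [::] => n.-1
  | l :: w' =>
      let p := tracked w' in
      if p == l.1 then l.1.+1 else if p == l.1.+1 then val l.1 else p
  end.

(* The braid inserted to the left of the letter l when the tracked strand is  *)
(* at position p; sigma_{i-1} in 1-based numbering is (j, true) with p = j+1, *)
(* and sigma_i^-1 is (j, false) with p = j.                                   *)
Definition insertion (n : nat) (p : nat) (l : letter n) : braid n :=
  if l.2 && (p == l.1.+1) then (flip n p)^-1
  else if ~~ l.2 && (p == l.1) then flip n p
  else 1.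

Fixpoint s_braid (n : nat) (w : bword n) : braid n :=
  match w with
  | [::] => 1
  | l :: w' => insertion (tracked w') l * braid_of [:: l] * s_braid w'
  end.

(* Main.v *)
Require Import Defs.
From HB Require Import structures.
From mathcomp Require Import all_boot fingroup perm ssralg ssrint.
From mathcomp Require Import zify.
From mathcomp Require Import boolp classical_sets functions.

(* Let [n] be the number of strands and let a braid act on pairs of a         *)
(* position, that of a tracked strand, and an element of a group [G] which    *)
(* records the motion of the other strands. Such an action exists as soon as  *)
(* [G] contains elements [s_j] satisfying the relations of [B_{n-1}] and      *)
(* elements [x_i], recording the passages of the tracked strand in front of   *)
(* another one, that are permuted by the [s_j] as the generators of a free    *)
(* group are under Artin's action. It is used for three choices of [G].       *)
(* - [G = B_{n-1}], [x_i] the flips: the pure braids act through a map to     *)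
(*   [P_{n-1}] which is [s], is the identity on [iota(P_{n-1})] and sends the *)
(*   generators of [R_n] to central elements. As [s(b)] and [b] agree modulo  *)
(*   [R_n], this gives both claims once the center of [P_{n-1}] is known.     *)
(* - [G = B_{n-1}], [x_i = 1]: this forgets the last strand, with kernel the  *)
(*   group generated by the loops of that strand around the others. By        *)
(*   induction a central pure braid is, up to a power of the full twist, a    *)
(*   word in these loops.                                                     *)
(* - [G] acting on tuples of bijections by Hurwitz moves, specialized to the  *)
(*   regular action of a free group on its reduced words: this shows that, if *)
(*   there are at least two loops, a word in the loops that commutes with all *)
(*   of them is trivial.                                                      *)

(** The flips of $B_{n-1}$ satisfy [artin_rels] ([flip_seq_artin]), so recording them at the
    passages in front gives a homomorphism [straighten] from $P_n$ to $P_{n-1}$. It computes $s$: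
    turning a passage in front into a passage behind costs exactly one flip of $B_n$ against one
    flip of $B_{n-1}$ ([flip_sweep]), so along the word $s(b)$ the tracked strand stays behind all
    the others ([s_braid_track]). In particular $s(b)$ does not depend on the word. Since $R_n$ is
    normal, $s(b)$ and $b$ agree modulo $R_n$ ([s_braid_trivial]).

    It remains to find the image of $R_n$. The flips $r_1,\dots,r_{n-1}$ go to 1 ([track_flip]),
    while $r_n$ goes to the inverse of the product of all flips of $B_{n-1}$ ([cocycle_flip_last]),
    which is central ([artin_prod_commute]); and $d_n=\iota(d_{n-1})r_n$ ([iota_full_twist]). Hence
    $R_n$ goes into the center of $P_{n-1}$, which is $\langle d_{n-1}\rangle$
    ([center_pure_braid]). Conversely $\iota(d_{n-1})=d_nr_n^{-1}$ lies in $R_n$. Together these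
    give [trivialE], from which both claims follow because [straighten] is a left inverse of
    $\iota$.

    The center is found by induction: forgetting the last strand sends a central pure braid to a
    power of $d_{n-1}$, hence up to a power of $d_n$ the braid is a word in the loops
    ([forget_decomp]), and the loops generate a free group, whose center is trivial from rank 2 on
    ([loops_center]). *)

Set Implicit Arguments.
Unset Strict Implicit.
Unset Printing Implicit Defensive.

Local Open Scope group_scope.
Local Open Scope classical_set_scope.

(** * Sequences satisfying the braid relations *)

(* [up g a k = g_a ... g_{a+k-1}] and [dn g a k = g_{a+k-1} ... g_a]. *)
Fixpoint up (G : groupType) (g : nat -> G) (a k : nat) : G :=
  if k is k'.+1 then up g a k' * g (a + k')%N else 1.

Fixpoint dn (G : groupType) (g : nat -> G) (a k : nat) : G :=
  if k is k'.+1 then g (a + k')%N * dn g a k' else 1.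

(** Stated for any sequence of [K] elements, so that the same lemmas serve in $B_n$ with [K = n.-1],
    in $B_{n-1}$, and in the image of $B_{n-1}$ in $B_n$. *)
HB.lock Definition flip_seq (G : groupType) (K : nat) (g : nat -> G) (p : nat) : G :=
  dn g 0 p * up g 0 K * dn g p (K - p).

Section BraidSequences.
Variable G : groupType.
Implicit Types (g s x : nat -> G) (y z : G).

Definition braid_seq (K : nat) g : Prop :=
  (forall i, (i.+1 < K)%N -> g i * g i.+1 * g i = g i.+1 * g i * g i.+1) /\
  (forall i j, (i.+1 < j < K)%N -> commute (g i) (g j)).

Lemma upD g a k l : up g a (k + l) = up g a k * up g (a + k) l.
Proof.
elim: l => [|l IHl]; first by rewrite addn0 mulg1.
by rewrite addnS /= IHl mulgA addnA.
Qed.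

Lemma dnD g a k l : dn g a (k + l) = dn g (a + k) l * dn g a k.
Proof.
elim: l => [|l IHl]; first by rewrite addn0 mul1g.
by rewrite addnS /= IHl mulgA addnA.
Qed.

Lemma upSl g a k : up g a k.+1 = g a * up g a.+1 k.
Proof. by rewrite -add1n upD /= addn0 mul1g addn1. Qed.

Lemma dnSr g a k : dn g a k.+1 = dn g a.+1 k * g a.
Proof. by rewrite -add1n dnD /= addn0 mulg1 addn1. Qed.

Lemma commute_up g a k y :
  (forall i, (a <= i < a + k)%N -> commute y (g i)) -> commute y (up g a k).
Proof.
elim: k => [|k IHk] yg; first exact: commute1.
by apply: commuteM; [apply: IHk => i ik; apply: yg; lia | apply: yg; lia].
Qed.

Lemma commute_dn g a k y :
  (forall i, (a <= i < a + k)%N -> commute y (g i)) -> commute y (dn g a k).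
Proof.
elim: k => [|k IHk] yg; first exact: commute1.
by apply: commuteM; [apply: yg; lia | apply: IHk => i ik; apply: yg; lia].
Qed.

Variables (K : nat) (g : nat -> G).
Hypothesis gK : braid_seq K g.

Lemma braid_seq_far i j :
  (i < K)%N -> (j < K)%N -> (i.+1 < j)%N || (j.+1 < i)%N -> commute (g i) (g j).
Proof.
move=> iK jK /orP[ij|ji]; first by apply: gK.2; rewrite ij.
by apply/commute_sym/gK.2; rewrite ji.
Qed.

Lemma braid_seqS i : (i.+1 < K)%N -> g i * g i.+1 * g i = g i.+1 * g i * g i.+1.
Proof. exact: gK.1. Qed.

(** [g i] commutes with every factor except [g i.+1 * g i], where the braid relation raises its
    index. *)
Lemma dn_shift a k i : (a <= i)%N -> (i.+1 < a + k <= K)%N ->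
  g i * dn g a k = dn g a k * g i.+1.
Proof.
move=> ai /andP[ik kK].
have -> : k = ((i - a) + 2 + (a + k - i.+2))%N by lia.
rewrite !dnD /= mulg1 addn0 !addn1.
have -> : (a + (i - a))%N = i by lia.
have -> : (a + (i - a + 2))%N = i.+2 by lia.
have c1 : commute (g i) (dn g i.+2 (a + k - i.+2)).
  by apply: commute_dn => j hj; apply: braid_seq_far; lia.
have c2 : commute (g i.+1) (dn g a (i - a)).
  by apply: commute_dn => j hj; apply: braid_seq_far; lia.
rewrite 2!mulgA c1 -!mulgA -c2; congr (_ * _).
by rewrite !mulgA braid_seqS //; lia.
Qed.

Lemma up_shift a k i : (a <= i)%N -> (i.+1 < a + k <= K)%N ->
  g i.+1 * up g a k = up g a k * g i.
Proof.
move=> ai /andP[ik kK].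
have -> : k = ((i - a) + 2 + (a + k - i.+2))%N by lia.
rewrite !upD /= mul1g addn0 !addn1.
have -> : (a + (i - a))%N = i by lia.
have -> : (a + (i - a + 2))%N = i.+2 by lia.
have c1 : commute (g i) (up g i.+2 (a + k - i.+2)).
  by apply: commute_up => j hj; apply: braid_seq_far; lia.
have c2 : commute (g i.+1) (up g a (i - a)).
  by apply: commute_up => j hj; apply: braid_seq_far; lia.
rewrite -[RHS]mulgA -c1 !mulgA c2; congr (_ * _).
by rewrite -!mulgA; congr (_ * _); rewrite !mulgA braid_seqS //; lia.
Qed.

(** Conjugation by $s_i$ sends $x_i$ to $x_{i+1}$ and $x_{i+1}$ to $x_{i+1}x_ix_{i+1}^{-1}$; the
    last condition replaces this second formula by the invariance of the product. *)
Definition artin_rels (k : nat) (s x : nat -> G) : Prop :=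
  [/\ forall i, (i.+1 < k)%N -> s i * x i = x i.+1 * s i,
      forall i j, (i < k)%N -> (j.+1 < k)%N -> j != i -> j.+1 != i ->
        commute (s j) (x i)
    & forall i, (i.+1 < k)%N -> commute (s i) (x i.+1 * x i)].

Local Notation r := (flip_seq K g).

Lemma flip_seqE p : r p = dn g 0 p * up g 0 K * dn g p (K - p).
Proof. by rewrite unlock. Qed.

Lemma flip_seqS p : (p < K)%N -> g p * r p = r p.+1 * g p.
Proof.
move=> pK; rewrite !flip_seqE /= add0n -!mulgA -dnSr.
by have -> : (K - p)%N = (K - p.+1).+1 by lia.
Qed.

Lemma flip_seq_far i j : (i <= K)%N -> (j < K)%N -> j != i -> j.+1 != i ->
  commute (g j) (r i).
Proof.
move=> iK jK ji jSi; rewrite /commute !flip_seqE.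
have [ij|ij] := ltnP i j.
  have c1 : commute (g j) (dn g 0 i).
    by apply: commute_dn => l hl; apply: braid_seq_far; lia.
  case: j => [//|j] in ij jK ji jSi c1 *.
  rewrite !mulgA c1 -!mulgA; congr (_ * _).
  by rewrite mulgA up_shift -?mulgA ?dn_shift //; lia.
have c1 : commute (g j) (dn g i (K - i)).
  by apply: commute_dn => l hl; apply: braid_seq_far; lia.
rewrite !mulgA dn_shift; [|lia|lia].
by rewrite -(mulgA _ _ (up _ _ _)) up_shift -?mulgA ?c1 //; lia.
Qed.

Lemma flip_seq_pair p : (p < K)%N ->
  commute (g p) (r p.+1 * r p).
Proof.
elim: p => [|p IHp] pK.
  have r1 : r 1 = g 0%N * r 0 * (g 0%N)^-1.
    by rewrite flip_seqS // mulgK.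
  (* Here $r_0=g_0Xg_0$ where $X$ avoids $g_0$ and therefore commutes with $r_0$. *)
  pose X := up g 1 K.-1 * dn g 1 K.-1.
  have r0 : r 0 = g 0%N * X * g 0%N.
    rewrite !flip_seqE /= mul1g subn0.
    case: K pK @X => [//|k] _ X.
    by rewrite upSl dnSr /X /= !mulgA.
  have cX : commute (r 0) X.
    apply: commuteM; [apply: commute_up | apply: commute_dn] => i hi;
    by apply/commute_sym/flip_seq_far; lia.
  have -> : r 1 * r 0 = g 0%N * (r 0 * X) * g 0%N.
    by rewrite r1 r0 !mulgA mulgK.
  apply: commuteM; last by [].
  apply: commuteM; first by [].
  by rewrite /commute {1}cX {1 2}r0 !mulgA.
(* Conjugation by $c$ raises the indices of $g_p$, $r_p$ and $r_{p+1}$ by one, which carries the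
   induction hypothesis to the goal. *)
set c := g p * g p.+1.
have cg : g p.+1 * c = c * g p by rewrite /c mulgA -braid_seqS.
have cr : r p.+1 * c = c * r p.
  rewrite /c mulgA -flip_seqS; last lia.
  by rewrite -!mulgA; congr (_ * _); symmetry; apply: flip_seq_far; lia.
have cr1 : r p.+2 * c = c * r p.+1.
  rewrite /c -[RHS]mulgA flip_seqS // !mulgA; congr (_ * _).
  by symmetry; apply: flip_seq_far; lia.
have conjE (y z : G) : y * c = c * z -> y = z ^ c^-1.
  by move=> e; rewrite conjgE invgK mulgA -e mulgK.
rewrite (conjE _ _ cg) (conjE _ _ cr) (conjE _ _ cr1).
by rewrite /commute -!conjMg IHp //; lia.
Qed.

Lemma flip_seq_artin : artin_rels K.+1 g r.
Proof.
split=> [i iK|i j iK jK|i iK]; [exact: flip_seqS | exact: flip_seq_far |].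
exact: flip_seq_pair.
Qed.

(** Each factor [dn g 0 K] is its top generator times [dn g 0 K.-1]; that generator moves to the
    left, its index dropping by one at each full factor crossed. *)
Lemma full_twist_seqE k : (k <= K)%N ->
  dn g 0 K ^+ k = up g (K - k) k * dn g 0 K.-1 ^+ k.
Proof.
elim: k => [|k IHk] kK; first by rewrite mul1g.
rewrite !expgS IHk 1?ltnW //.
have dup : forall l a, (a.+1 + l <= K)%N ->
    dn g 0 K * up g a.+1 l = up g a l * dn g 0 K.
  elim=> [|l IHl] a al /=; first by rewrite mul1g mulg1.
  rewrite mulgA IHl; last lia.
  by rewrite -!mulgA; congr (_ * _); rewrite addSn dn_shift //; lia.
rewrite mulgA; have -> : (K - k = (K - k.+1).+1)%N by lia.
rewrite dup; last lia.
case: K kK {dup IHk} => [//|K'] kK /=.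
by rewrite add0n -!mulgA; congr (_ * (_ * _)); congr g; lia.
Qed.

Lemma full_twist_seq_rec :
  dn g 0 K ^+ K.+1 = dn g 0 K.-1 ^+ K * r K.
Proof.
have -> : r K = dn g 0 K * up g 0 K by rewrite !flip_seqE subnn mulg1.
have c : commute (dn g 0 K.-1 ^+ K) (dn g 0 K * up g 0 K).
  have -> : dn g 0 K * up g 0 K = r K by rewrite !flip_seqE subnn mulg1.
  apply/commute_sym/commuteX/commute_dn => i iK.
  by symmetry; apply: flip_seq_far; lia.
by rewrite c expgS full_twist_seqE // subnn mulgA.
Qed.

Lemma full_twist_seq_central i : (i < K)%N -> commute (g i) (dn g 0 K ^+ K.+1).
Proof.
move=> iK; set d := dn g 0 K.
have sh j k : (j + k < K)%N -> g j * d ^+ k = d ^+ k * g (j + k)%N.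
  elim: k => [|k IHk] jk; first by rewrite addn0 mul1g mulg1.
  rewrite expgSr mulgA IHk; last lia.
  by rewrite -!mulgA dn_shift ?addnS //; lia.
(* At the top index the shift leaves the range; two factors bring it back to index 0. *)
have sh2 : g K.-1 * (d * d) = d * d * g 0%N.
  have E1 : d = g K.-1 * dn g 0 K.-1.
    by rewrite /d; case: K iK => [//|k] _ /=; rewrite add0n.
  have E2 : d = dn g 1 K.-1 * g 0%N.
    by rewrite /d; case: K iK => [//|k] _; rewrite dnSr.
  have E3 : d * dn g 1 K.-1 = dn g 0 K.-1 * d.
    have F l : (l < K)%N -> d * dn g 1 l = dn g 0 l * d.
      elim: l => [|l IHl] lK /=; first by rewrite mul1g mulg1.
      rewrite mulgA -dn_shift; [|lia|lia].
      by rewrite -mulgA IHl ?mulgA //; lia.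
    by apply: F; lia.
  by rewrite {2}E2 !mulgA -(mulgA _ d) E3 !mulgA -E1.
(* The index rises from [i] to [K.-1], wraps around to 0 in two steps, and rises to [i] again. *)
have -> : K.+1 = ((K.-1 - i) + (2 + i))%N by lia.
have eA : g i * d ^+ (K.-1 - i) = d ^+ (K.-1 - i) * g K.-1.
  by rewrite sh; [congr (_ * g _) |]; lia.
have eB : g K.-1 * d ^+ (2 + i) = d ^+ (2 + i) * g i.
  have e0 : g 0%N * d ^+ i = d ^+ i * g i by apply: sh.
  rewrite expgnDr expg2; move: (d * d) (d ^+ i) sh2 e0 => dd di sh2 e0.
  by rewrite mulgA sh2 -mulgA e0 mulgA.
rewrite expgnDr; move: (d ^+ _) (d ^+ _) eA eB => A B eA eB.
by rewrite /commute mulgA eA -mulgA eB mulgA.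
Qed.

End BraidSequences.

(** * Generators, flips and the full twist in the braid group *)

Lemma morph_mul1 (G H : groupType) (f : G -> H) : {morph f : x y / x * y} -> f 1 = 1.
Proof. by move=> fM; apply: (mulgI (f 1)); rewrite -fM !mulg1. Qed.

Lemma morph_mulV (G H : groupType) (f : G -> H) :
  {morph f : x y / x * y} -> {morph f : x / x^-1}.
Proof.
by move=> fM x; apply: (mulgI (f x)); rewrite -fM !mulgV (morph_mul1 fM).
Qed.

Lemma morph_mulX (G H : groupType) (f : G -> H) :
  {morph f : x y / x * y} -> forall k, {morph f : x / x ^+ k}.
Proof.
move=> fM k x; elim: k => [|k IHk]; first exact: morph_mul1.
by rewrite !expgS fM IHk.
Qed.

(* Generators indexed by natural numbers, with value 1 out of range. *)
Definition gen (n j : nat) : braid n := oapp (@sigma n) 1 (insub j).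

Lemma genE n (j : 'I_n.-1) : gen n j = sigma j.
Proof. by rewrite /gen valK. Qed.

Lemma gen_sigma n j (jn : (j < n.-1)%N) : gen n j = sigma (Ordinal jn).
Proof. by rewrite -genE. Qed.

Lemma gen_braid_seq n : braid_seq n.-1 (gen n).
Proof.
split=> [i ik|i j /andP[ij jk]].
  rewrite (gen_sigma ik) (gen_sigma (ltnW ik)).
  by apply: (sigma_rels n).1.
have ik : (i < n.-1)%N by lia.
by rewrite (gen_sigma ik) (gen_sigma jk); apply: (sigma_rels n).2.
Qed.

Lemma braid_ind n (P : braid n -> Prop) : P 1 ->
  (forall j b, (j < n.-1)%N -> P b -> P (gen n j * b)) ->
  (forall j b, (j < n.-1)%N -> P b -> P ((gen n j)^-1 * b)) ->
  forall b, P b.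
Proof.
move=> P1 Pg PV b; rewrite -(cls_repr b); elim: (generic_quotient.repr b) => [//|[j e] w IHw].
have -> : cls ((j, e) :: w) = cls [:: (j, e)] * cls w by rewrite clsM.
case: e; first by rewrite -/(sigma j) -genE; apply: Pg.
by rewrite -[cls [:: (j, false)]](clsV [:: (j, true)]) -/(sigma j) -genE; apply: PV.
Qed.

Lemma commute_gen n (x : braid n) :
  (forall j, (j < n.-1)%N -> commute x (gen n j)) -> forall b, commute x b.
Proof.
move=> xg; elim/braid_ind => [|j b jn xb|j b jn xb]; first exact: commute1.
  by apply: commuteM => //; apply: xg.
by apply: commuteM => //; apply/commuteV/xg.
Qed.

Lemma prod_iota_up n k : (k <= n.-1)%N ->
  \prod_(i <- iota 0 k) gen n i = up (gen n) 0 k.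
Proof.
elim: k => [|k IHk] kn; first by rewrite big_nil.
by rewrite -addn1 iotaD big_cat /= big_seq1 IHk 1?ltnW // addn1.
Qed.

Lemma prod_ord_gen n (P : pred nat) (r : seq 'I_n.-1) :
  \prod_(j <- r | P j) sigma j = \prod_(i <- map val r | P i) gen n i :> braid n.
Proof. by rewrite big_map; apply: eq_bigr => j _; rewrite genE. Qed.

Lemma prod_rev_iota n a k :
  \prod_(i <- rev (iota a k)) gen n i = dn (gen n) a k.
Proof.
elim: k => [|k IHk]; first by rewrite big_nil.
by rewrite -addn1 iotaD rev_cat big_cat /= big_seq1 IHk addn1.
Qed.

Lemma full_twistE n : full_twist n = dn (gen n) 0 n.-1 ^+ n.
Proof.
rewrite /full_twist; congr (_ ^+ _).
by rewrite (prod_ord_gen predT) map_rev val_enum_ord prod_rev_iota.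
Qed.

Lemma flipE n p : (p < n)%N -> flip n p = flip_seq n.-1 (gen n) p.
Proof.
move=> pn; rewrite unlock /flip; congr (_ * _ * _).
- rewrite (prod_ord_gen (fun j => (j < p)%N)) map_rev val_enum_ord.
  have -> : iota 0 n.-1 = iota 0 p ++ iota p (n.-1 - p).
    by rewrite -iotaD subnKC //; lia.
  rewrite rev_cat big_cat /= big_seq_cond big_pred0 ?mul1g; last first.
    by move=> i; rewrite mem_rev mem_iota; lia.
  rewrite -prod_rev_iota -big_filter; congr (\big[_/_]_(i <- _) _).
  by apply/all_filterP/allP => i; rewrite mem_rev mem_iota; lia.
- rewrite (prod_ord_gen predT) val_enum_ord.
  exact: prod_iota_up.
- rewrite (prod_ord_gen (fun j => (p <= j)%N)) map_rev val_enum_ord.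
  have -> : iota 0 n.-1 = iota 0 p ++ iota p (n.-1 - p).
    by rewrite -iotaD subnKC //; lia.
  rewrite rev_cat big_cat /= [X in _ * X]big_seq_cond [X in _ * X]big_pred0 ?mulg1; last first.
    by move=> i; rewrite mem_rev mem_iota; lia.
  rewrite -prod_rev_iota -big_filter; congr (\big[_/_]_(i <- _) _).
  by apply/all_filterP/allP => i; rewrite mem_rev mem_iota; lia.
Qed.

Lemma iota_braid1 n : iota_braid 1 = 1 :> braid n.
Proof. exact: morph_mul1 (@iota_braidM n). Qed.

Lemma iota_braidV n : {morph @iota_braid n : c / c^-1}.
Proof. exact: morph_mulV (@iota_braidM n). Qed.

Lemma iota_gen n j : (j < n.-2)%N -> iota_braid (gen n.-1 j) = gen n j.
Proof.
move=> jn; rewrite (gen_sigma jn) iota_braid_sigma.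
have jn' : (j < n.-1)%N by lia.
by rewrite (gen_sigma jn'); congr sigma; apply: val_inj.
Qed.

Lemma iota_up n a k : (a + k <= n.-2)%N ->
  iota_braid (up (gen n.-1) a k) = up (gen n) a k.
Proof.
elim: k => [|k IHk] akn /=; first exact: iota_braid1.
by rewrite iota_braidM IHk ?iota_gen //; lia.
Qed.

Lemma iota_dn n a k : (a + k <= n.-2)%N ->
  iota_braid (dn (gen n.-1) a k) = dn (gen n) a k.
Proof.
elim: k => [|k IHk] akn /=; first exact: iota_braid1.
by rewrite iota_braidM IHk ?iota_gen //; lia.
Qed.

Section Permutation.
Variable n : nat.

Lemma braid_perm1 : braid_perm (1 : braid n) = 1.
Proof. exact: morph_mul1 (@braid_permM n). Qed.

Lemma braid_permV : {morph @braid_perm n : b / b^-1}.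
Proof. exact: morph_mulV (@braid_permM n). Qed.

Lemma braid_perm_genV j : (j < n.-1)%N -> braid_perm (gen n j)^-1 = braid_perm (gen n j).
Proof.
by move=> jn; rewrite (gen_sigma jn) braid_permV braid_perm_sigma tpermV.
Qed.

Lemma pure_subgroup : subgroup (@pure_braid n).
Proof.
split=> [|x y|x]; rewrite /pure_braid /= ?braid_perm1 //.
  by rewrite braid_permM => -> ->; rewrite mulg1.
by rewrite braid_permV => ->; rewrite invg1.
Qed.

Lemma pure_conj (a b : braid n) : pure_braid b -> pure_braid (a * b * a^-1).
Proof. by rewrite /pure_braid /= !braid_permM braid_permV => ->; rewrite mulg1 mulgV. Qed.

Lemma pure_gen_conj j b : (j < n.-1)%N -> pure_braid b -> pure_braid (gen n j * b * gen n j).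
Proof.
move=> jn; rewrite /pure_braid /= !braid_permM => ->.
by rewrite mulg1 -{1}braid_perm_genV // braid_permV mulVg.
Qed.

(** The first flip is the palindrome $g_0\cdots g_{n-2}g_{n-2}\cdots g_0$, and the others are its
    conjugates by [flip_seqS]. *)
Lemma pure_flip_seq p : (p < n)%N -> pure_braid (flip_seq n.-1 (gen n) p).
Proof.
elim: p => [|p IHp] pn.
  rewrite unlock /= mul1g subn0.
  suff H : forall k a, (a + k <= n.-1)%N -> pure_braid (up (gen n) a k * dn (gen n) a k).
    exact: H.
  elim=> [|k IHk] a ak; first by rewrite /= mulg1; case: pure_subgroup.
  rewrite upSl dnSr.
  have -> : gen n a * up (gen n) a.+1 k * (dn (gen n) a.+1 k * gen n a) =
    gen n a * (up (gen n) a.+1 k * dn (gen n) a.+1 k) * gen n a by rewrite !mulgA.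
  by apply: pure_gen_conj; [lia | apply: IHk; lia].
have -> : flip_seq n.-1 (gen n) p.+1 = gen n p * flip_seq n.-1 (gen n) p * (gen n p)^-1.
  by rewrite flip_seqS ?mulgK //; lia.
by apply/pure_conj/IHp; lia.
Qed.

Lemma pure_flip p : (p < n)%N -> pure_braid (flip n p).
Proof. by move=> pn; rewrite flipE //; apply: pure_flip_seq. Qed.

End Permutation.

Lemma braid_perm_iota n (c : braid n.-1) :
  (forall p : 'I_n.-1, braid_perm (iota_braid c) (widen_ord (leq_pred n) p) =
     widen_ord (leq_pred n) (braid_perm c p)) /\
  (forall p : 'I_n, p.+1 = n -> braid_perm (iota_braid c) p = p).
Proof.
have G (j : nat) (jn : (j < n.-2)%N) :
  (forall p : 'I_n.-1, braid_perm (gen n j) (widen_ord (leq_pred n) p) =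
     widen_ord (leq_pred n) (braid_perm (gen n.-1 j) p)) /\
  (forall p : 'I_n, p.+1 = n -> braid_perm (gen n j) p = p).
  have jn' : (j < n.-1)%N by lia.
  rewrite (gen_sigma jn) (gen_sigma jn') !braid_perm_sigma /adj_transp.
  split=> [p|p pn]; last by rewrite tpermD // -val_eqE /=; lia.
  have w_inj : injective (widen_ord (leq_pred n)).
    by move=> a b /(congr1 val) ab; apply: val_inj.
  rewrite (inj_tperm _ _ _ w_inj).
  by congr (tperm _ _ _); apply: val_inj.
elim/braid_ind: c => [|j c jn [IH1 IH2]|j c jn [IH1 IH2]].
- rewrite iota_braid1 !braid_perm1.
  by split=> p *; rewrite !perm1.
- rewrite iota_braidM iota_gen // !braid_permM; have [G1 G2] := G j jn.
  by split=> p *; rewrite !permM ?G1 ?IH1 // G2 // IH2.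
- rewrite iota_braidM iota_braidV iota_gen // !braid_permM.
  rewrite !braid_perm_genV //; last lia.
  have [G1 G2] := G j jn.
  by split=> p *; rewrite !permM ?G1 ?IH1 // G2 // IH2.
Qed.

Lemma pure_iota n (c : braid n.-1) : pure_braid (iota_braid c) <-> pure_braid c.
Proof.
have [I1 I2] := braid_perm_iota c.
rewrite /pure_braid /=; split=> [e|e]; apply/permP => p; rewrite perm1.
  apply/val_inj; have := I1 p; rewrite e perm1 => /(congr1 val) /= <- //.
have [pn|pn] := eqVneq (p.+1) n; first exact: I2.
have pn' : (p < n.-1)%N by have := ltn_ord p; lia.
have -> : p = widen_ord (leq_pred n) (Ordinal pn') by apply: val_inj.
by rewrite I1 e perm1.
Qed.

Lemma iota_full_twist n : (1 < n)%N ->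
  full_twist n = iota_braid (full_twist n.-1) * flip n n.-1.
Proof.
move=> n1; rewrite !full_twistE flipE; last lia.
have -> : dn (gen n) 0 n.-1 ^+ n = dn (gen n) 0 n.-1 ^+ n.-1.+1.
  by congr (_ ^+ _); lia.
rewrite (full_twist_seq_rec (gen_braid_seq n)).
rewrite (morph_mulX (@iota_braidM n)) iota_dn //; lia.
Qed.

Lemma full_twist_central n (b : braid n) : (0 < n)%N -> commute (full_twist n) b.
Proof.
move=> n0; apply: commute_gen => j jn; rewrite full_twistE.
have -> : dn (gen n) 0 n.-1 ^+ n = dn (gen n) 0 n.-1 ^+ n.-1.+1.
  by congr (_ ^+ _); lia.
by apply/commute_sym/(full_twist_seq_central (gen_braid_seq n)).
Qed.

Lemma pure_full_twist n : (0 < n)%N -> pure_braid (full_twist n).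
Proof.
case: n => [//|n] _; elim: n => [|n IHn].
  by rewrite full_twistE /= expg1; case: (pure_subgroup 1).
rewrite iota_full_twist //; case: (pure_subgroup n.+2) => _ pM _; apply: pM.
  by apply/(@pure_iota n.+2).
exact: pure_flip.
Qed.

(** * Groups of bijections *)

(** The inverse is kept as data, so that composition makes these maps a [groupType] in which
    [braid_lift] can take its values. *)
Record bijection (T : Type) := Bijection {
  bfun :> T -> T;
  binv : T -> T;
  bfunK : cancel bfun binv;
  binvK : cancel binv bfun }.

HB.instance Definition _ T := gen_eqMixin (bijection T).
HB.instance Definition _ T := gen_choiceMixin (bijection T).

Section Bijections.
Variable T : Type.
Implicit Types f g : bijection T.

Lemma bijection_eq f g : bfun f =1 bfun g -> f = g.
Proof.
case: f g => [f f' fK f'K] [g g' gK g'K] /= /funext fg; subst g.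
have fg' : f' = g' by apply/funext => y; rewrite -{1}(g'K y) fK.
by subst g'; congr Bijection; exact: Prop_irrelevance.
Qed.

Definition bijection_one : bijection T := @Bijection T id id (frefl _) (frefl _).
Definition bijection_mul f g : bijection T :=
  Bijection (can_comp (bfunK f) (bfunK g)) (can_comp (binvK g) (binvK f)).
Definition bijection_inv f : bijection T := Bijection (binvK f) (bfunK f).

Lemma bijection_mulA : associative bijection_mul.
Proof. by move=> f g h; apply: bijection_eq. Qed.
Lemma bijection_mul1 : left_id bijection_one bijection_mul.
Proof. by move=> f; apply: bijection_eq. Qed.
Lemma bijection_mulr1 : right_id bijection_one bijection_mul.
Proof. by move=> f; apply: bijection_eq. Qed.
Lemma bijection_mulV : left_inverse bijection_one bijection_inv bijection_mul.
Proof. by move=> f; apply: bijection_eq => x /=; rewrite bfunK. Qed.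
Lemma bijection_mulrV : right_inverse bijection_one bijection_inv bijection_mul.
Proof. by move=> f; apply: bijection_eq => x /=; rewrite binvK. Qed.

HB.instance Definition _ := isGroup.Build (bijection T)
  bijection_mulA bijection_mul1 bijection_mulr1 bijection_mulV bijection_mulrV.

Lemma bfunM f g x : (f * g) x = f (g x). Proof. by []. Qed.
Lemma bfunVK f x : f^-1 (f x) = x. Proof. exact: bfunK. Qed.
Lemma bfunKV f x : f (f^-1 x) = x. Proof. exact: binvK. Qed.

End Bijections.

(** * Tracking a strand *)

(* [B_n] acts on [n] copies of [G] (the tracked strand being at one of [n]    *)
(* positions) as soon as the [s_j] satisfy the relations of [B_{n-1}] and     *)
(* conjugate the [x_i] as in Artin's action on a free group: the tracked      *)
(* strand passing in front of another one is recorded by some [x_i^-1] or     *)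
(* [x_i], its passing behind by nothing.                                      *)
Section Tracking.
Variables (n : nat) (G : groupType) (s x : nat -> G).

(** With the tracked strand removed, the crossing [j] of the other strands has number [j.-1] or [j]
    according to the side on which the tracked strand lies. Positions from [n] on are fixed, because
    there [s n.-2] could occur, on which no relation is assumed. *)
Definition track_fun (j : nat) (q : nat * G) : nat * G :=
  let: (p, g) := q in
  if p == j.+1 then (j, (x j)^-1 * g)
  else if p == j then (j.+1, g)
  else if (p < j)%N then (p, s j.-1 * g)
  else if (p < n)%N then (p, s j * g) else (p, g).

Definition track_inv (j : nat) (q : nat * G) : nat * G :=
  let: (p, g) := q in
  if p == j then (j.+1, x j * g)
  else if p == j.+1 then (j, g)
  else if (p < j)%N then (p, (s j.-1)^-1 * g)
  else if (p < n)%N then (p, (s j)^-1 * g) else (p, g).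

#[global] Arguments track_fun : simpl never.
#[global] Arguments track_inv : simpl never.

Lemma track_funK j : cancel (track_fun j) (track_inv j).
Proof.
case=> p g; rewrite /track_fun /track_inv.
case: (eqVneq p j.+1) => [->|p1]; first by rewrite eqxx mulVKg.
case: (eqVneq p j) => [->|p2]; first by rewrite eqxx ifN //; lia.
case: ltnP => p3; first by rewrite (negPf p1) (negPf p2) p3 mulKg.
by case: ltnP => p4; rewrite (negPf p1) (negPf p2) ltnNge p3 /= ?p4 ?mulKg // ltnNge p4.
Qed.

Lemma track_invK j : cancel (track_inv j) (track_fun j).
Proof.
case=> p g; rewrite /track_fun /track_inv.
case: (eqVneq p j) => [->|p2]; first by rewrite eqxx mulKg.
case: (eqVneq p j.+1) => [->|p1]; first by rewrite eqxx ifN //; lia.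
case: ltnP => p3; first by rewrite (negPf p1) (negPf p2) p3 mulVKg.
by case: ltnP => p4; rewrite (negPf p1) (negPf p2) ltnNge p3 /= ?p4 ?mulVKg // ltnNge p4.
Qed.

Definition track_gen (j : nat) : bijection (nat * G) :=
  Bijection (track_funK j) (track_invK j).

Lemma track_fun_lo j g : track_fun j (j.+1, g) = (j, (x j)^-1 * g).
Proof. by rewrite /track_fun eqxx. Qed.
Lemma track_fun_hi j g : track_fun j (j, g) = (j.+1, g).
Proof. by rewrite /track_fun eqxx ifN //; lia. Qed.
Lemma track_fun_lt j p g : (p < j)%N -> track_fun j (p, g) = (p, s j.-1 * g).
Proof. by move=> pj; rewrite /track_fun pj !ifN //; lia. Qed.
Lemma track_fun_gt j p g : (j.+1 < p)%N -> (p < n)%N -> track_fun j (p, g) = (p, s j * g).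
Proof.
move=> jp pn; rewrite /track_fun pn.
by rewrite !ifN //; lia.
Qed.
Lemma track_fun_ge j p g : (j.+1 < p)%N -> (n <= p)%N -> track_fun j (p, g) = (p, g).
Proof. by move=> jp pn; rewrite /track_fun !ifN //; lia. Qed.

Hypothesis sB : braid_seq n.-2 s.
Hypothesis sx : artin_rels n.-1 s x.

Lemma track_braid i : (i.+1 < n.-1)%N ->
  track_gen i * track_gen i.+1 * track_gen i =
  track_gen i.+1 * track_gen i * track_gen i.+1.
Proof.
move=> iN; apply: bijection_eq => -[p g]; rewrite !bfunM /=.
case: (ltnP p i) => p1.
  rewrite !track_fun_lt; try lia.
  congr (_, _); rewrite !mulgA; congr (_ * _).
  case: i iN p1 => [|i] // iN p1; apply: sB.1; lia.
case: (eqVneq p i) => [->|p2].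
  rewrite !track_fun_hi (@track_fun_lt i.+1 i) // !track_fun_hi.
  by rewrite track_fun_gt //; lia.
case: (eqVneq p i.+1) => [->|p3].
  rewrite (track_fun_lo i) (@track_fun_lt i.+1 i) // !track_fun_hi.
  rewrite (@track_fun_gt i); try lia.
  rewrite track_fun_lo /= !mulgA; congr (_, _ * _).
  by have [/(_ i) h _ _] := sx; apply: (mulgI (x i.+1)); rewrite mulVKg mulgA -h // mulgK.
case: (eqVneq p i.+2) => [->|p4].
  rewrite (@track_fun_gt i i.+2); try lia.
  rewrite !track_fun_lo (@track_fun_lt i.+1 i) //=.
  have [_ _ /(_ i iN) h] := sx; congr (_, _); rewrite !mulgA; congr (_ * _).
  by rewrite -!invMg; symmetry; rewrite -mulgA -invMg; apply: commuteV.
case: (ltnP p n) => p5; last by rewrite !track_fun_ge //; lia.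
rewrite !track_fun_gt; try lia.
by congr (_, _); rewrite !mulgA; congr (_ * _); apply: sB.1; lia.
Qed.

Lemma track_far i j : (i.+1 < j)%N -> (j < n.-1)%N ->
  track_gen i * track_gen j = track_gen j * track_gen i.
Proof.
move=> ij jN; apply: bijection_eq => -[p g]; rewrite !bfunM /=.
have [_ h _] := sx.
case: (ltnP p i) => p1.
  rewrite !track_fun_lt; try lia.
  congr (_, _); rewrite !mulgA; congr (_ * _); apply: sB.2; lia.
case: (eqVneq p i) => [->|p2].
  rewrite (track_fun_hi i) (@track_fun_lt j i) ?(@track_fun_lt j i.+1) //; try lia.
  by rewrite track_fun_hi.
case: (eqVneq p i.+1) => [->|p3].
  rewrite (track_fun_lo i) (@track_fun_lt j i.+1) // (@track_fun_lt j i); try lia.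
  rewrite track_fun_lo.
  congr (_, _); rewrite !mulgA; congr (_ * _).
  by symmetry; apply/commuteV/h; lia.
case: (ltnP p j) => p4.
  rewrite (@track_fun_gt i) ?(@track_fun_lt j) ?(@track_fun_gt i) //; try lia.
  by congr (_, _); rewrite !mulgA; congr (_ * _); apply: sB.2; lia.
case: (eqVneq p j) => [->|p5].
  by rewrite (track_fun_hi j) (@track_fun_gt i j) ?(@track_fun_gt i j.+1) ?track_fun_hi //; lia.
case: (eqVneq p j.+1) => [->|p6].
  rewrite (track_fun_lo j) (@track_fun_gt i j) ?(@track_fun_gt i j.+1) ?track_fun_lo //; try lia.
  congr (_, _); rewrite !mulgA; congr (_ * _).
  by apply/commuteV/h; lia.
case: (ltnP p n) => p7; last by rewrite !track_fun_ge //; lia.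
rewrite !track_fun_gt; try lia.
by congr (_, _); rewrite !mulgA; congr (_ * _); apply: sB.2; lia.
Qed.

Definition track : braid n -> bijection (nat * G) :=
  braid_lift (fun j => track_gen (val j)).

Lemma track_rels : braid_rels (fun j : 'I_n.-1 => track_gen (val j)).
Proof.
split=> i j ij; last by apply: track_far => //; exact: ltn_ord.
by rewrite (ij : val j = _); apply: track_braid; rewrite -ij.
Qed.

Lemma trackM : {morph track : a b / a * b}.
Proof. exact: braid_liftM track_rels. Qed.

Lemma trackE a b q : track (a * b) q = track a (track b q).
Proof. by rewrite trackM. Qed.

Lemma trackV b q : track b^-1 q = (track b)^-1 q.
Proof. by rewrite (morph_mulV trackM). Qed.

Lemma track1 q : track 1 q = q.
Proof. by rewrite (morph_mul1 trackM). Qed.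

Lemma track_genE j q : (j < n.-1)%N -> track (gen n j) q = track_fun j q.
Proof. by move=> jn; rewrite (gen_sigma jn) /track braid_lift_sigma //; exact: track_rels. Qed.

Lemma track_genV j q : (j < n.-1)%N -> track (gen n j)^-1 q = track_inv j q.
Proof.
move=> jn; rewrite trackV -{1}(track_invK j q) -track_genE //; exact: bfunVK.
Qed.

(** Letters multiply the second component on the left, so right multiplications commute with the
    action. This is what makes [cocycle] multiplicative on pure braids. *)
Lemma track_mulr b p g h :
  track b (p, g * h) = ((track b (p, g)).1, (track b (p, g)).2 * h).
Proof.
elim/braid_ind: b p g => [|j b jn IHb|j b jn IHb] p g; first by rewrite !track1.
  rewrite !trackE IHb !track_genE //; case: (track b (p, g)) => p' g'.
  by rewrite /track_fun /=; do !case: ifP => _; rewrite ?mulgA.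
rewrite !trackE IHb !track_genV //; case: (track b (p, g)) => p' g'.
by rewrite /track_inv /=; do !case: ifP => _; rewrite ?mulgA.
Qed.

Definition cocycle b : G := (track b (n.-1, 1)).2.

(** The inverse comes from the order of composition in ['S_n], opposite to that of the action. *)
Lemma track_pos b (p : 'I_n) g : (track b (nat_of_ord p, g)).1 = (braid_perm b)^-1 p.
Proof.
have key (j : 'I_n.-1) (q : 'I_n) : adj_transp j q =
    (if q == j.+1 :> nat then val j else if q == j :> nat then j.+1 else q) :> nat.
  rewrite /adj_transp; case: tpermP => [->|->|/eqP h1 /eqP h2] /=.
  - by rewrite eqxx ifN //; lia.
  - by rewrite eqxx.
  by move: h1 h2; rewrite -!val_eqE /= => /negPf-> /negPf->.
elim/braid_ind: b => [|j b jn IHb|j b jn IHb].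
- by rewrite track1 braid_perm1 invg1 perm1.
- rewrite trackE track_genE // (gen_sigma jn) braid_permM invMg permM braid_perm_sigma tpermV.
  rewrite key -IHb; case: (track b _) => p' g' /=.
  by rewrite /track_fun; do !case: ifP.
- rewrite trackE track_genV // braid_permM braid_perm_genV // invMg permM.
  rewrite (gen_sigma jn) braid_perm_sigma tpermV key -IHb; case: (track b _) => p' g' /=.
  rewrite /track_inv; case: (eqVneq p' j) => [->|_] /=; first by rewrite ifN //; lia.
  by do !case: ifP.
Qed.

Lemma track_pure b p g : pure_braid b -> (p < n)%N -> (track b (p, g)).1 = p.
Proof.
by move=> bP pn; rewrite -[p]/(val (Ordinal pn)) track_pos bP invg1 perm1.
Qed.

Lemma track_last b g : (0 < n)%N -> pure_braid b -> track b (n.-1, g) = (n.-1, cocycle b * g).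
Proof.
move=> n0 bP; rewrite -{1}[g]mul1g track_mulr track_pure //; lia.
Qed.

Lemma cocycleM a b : (0 < n)%N -> pure_braid a -> pure_braid b ->
  cocycle (a * b) = cocycle a * cocycle b.
Proof.
by move=> n0 aP bP; rewrite {1}/cocycle trackE track_last // track_last //= mulg1.
Qed.

Lemma cocycleV a : (0 < n)%N -> pure_braid a -> cocycle a^-1 = (cocycle a)^-1.
Proof.
move=> n0 aP; have [_ _ pV] := @pure_subgroup n.
apply: (mulgI (cocycle a)); rewrite -cocycleM ?mulgV //; last exact: pV.
by rewrite /cocycle track1.
Qed.

Lemma track_iota c g : (1 < n)%N ->
  track (iota_braid c) (n.-1, g) = (n.-1, braid_lift (fun j => s (val j)) c * g).
Proof.
move=> n1; set f := fun j : 'I_n.-2 => s (val j).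
have fR : braid_rels f.
  split=> i j ij; rewrite /f; first by rewrite (ij : val j = _); apply: sB.1; rewrite -ij.
  by apply: sB.2; rewrite ij ltn_ord.
have fM := braid_liftM fR.
have fg j : (j < n.-2)%N -> braid_lift f (gen n.-1 j) = s j.
  by move=> jn; rewrite (gen_sigma jn) braid_lift_sigma.
elim/braid_ind: c g => [|j c jn IHc|j c jn IHc] g.
- by rewrite iota_braid1 track1 (morph_mul1 fM) mul1g.
- rewrite iota_braidM trackE IHc iota_gen // track_genE; last lia.
  by rewrite track_fun_gt ?fM ?fg ?mulgA //; lia.
- rewrite iota_braidM trackE IHc iota_braidV iota_gen // trackV.
  apply: (can_inj (@bfunVK _ (track (gen n j)))); rewrite bfunKV /= track_genE; last lia.
  rewrite track_fun_gt; try lia.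
  by rewrite fM (morph_mulV fM) fg // -mulgA mulVKg.
Qed.

Lemma cocycle_iota c : (1 < n)%N ->
  cocycle (iota_braid c) = braid_lift (fun j => s (val j)) c.
Proof. by move=> n1; rewrite /cocycle track_iota // mulg1. Qed.

Lemma track_up k g : (k < n)%N ->
  track (up (gen n) 0 k) (k, g) = (0%N, (dn x 0 k)^-1 * g).
Proof.
elim: k g => [|k IHk] g kn /=; first by rewrite track1 invg1 mul1g.
rewrite trackE add0n track_genE; last lia.
by rewrite track_fun_lo IHk 1?ltnW // invMg mulgA.
Qed.

Lemma track_dn p k g : (p + k < n)%N ->
  track (dn (gen n) p k) (p, g) = ((p + k)%N, g).
Proof.
elim: k g => [|k IHk] g kn /=; first by rewrite track1 addn0.
rewrite trackE IHk ?track_genE; try lia.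
by rewrite track_fun_hi addnS.
Qed.

(** The last strand goes to the left end in front of all the others and returns behind them. *)
Lemma cocycle_flip_last : (0 < n)%N ->
  cocycle (flip n n.-1) = (dn x 0 n.-1)^-1.
Proof.
move=> n0; rewrite flipE; last lia.
rewrite /cocycle unlock subnn /= mulg1 trackE track_up ?track_dn //=; try lia.
by rewrite mulg1.
Qed.

End Tracking.

Lemma braid_lift_gen n (c : braid n) : braid_lift (fun j => gen n (val j)) c = c.
Proof.
have gR : braid_rels (fun j : 'I_n.-1 => gen n (val j)).
  by split=> i j ij; rewrite !genE; [apply: (sigma_rels n).1 | apply: (sigma_rels n).2].
elim/braid_ind: c => [|j c jn IHc|j c jn IHc].
- exact: morph_mul1 (braid_liftM gR).
- by rewrite (braid_liftM gR) IHc {1}(gen_sigma jn) braid_lift_sigma.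
- rewrite (braid_liftM gR) IHc (morph_mulV (braid_liftM gR)).
  by rewrite {1}(gen_sigma jn) braid_lift_sigma.
Qed.

(** * Subgroups and loops *)

Section Subgroups.
Variable G : groupType.
Implicit Types (H X : set G).

Lemma gen_subgroupP X : subgroup (gen_subgroup X).
Proof.
split=> [H [[] //]|x y Xx Xy H HX|x Xx H HX]; have [[H1 HM HV] _] := HX.
  by apply: HM; [apply: Xx | apply: Xy].
by apply: HV; apply: Xx.
Qed.

Lemma gen_subgroup_in X x : X x -> gen_subgroup X x.
Proof. exact: sub_gen_smallest. Qed.

Lemma gen_subgroup_min X H : subgroup H -> X `<=` H -> gen_subgroup X `<=` H.
Proof. by move=> HS XH; apply: smallest_sub. Qed.

Lemma subgroup_conj X a : (forall y, X y -> gen_subgroup X (a * y * a^-1)) ->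
  forall y, gen_subgroup X y -> gen_subgroup X (a * y * a^-1).
Proof.
move=> aX; have [X1 XM XV] := gen_subgroupP X.
apply: gen_subgroup_min aX; split=> [|x y|x] /=.
- by rewrite mulg1 mulgV.
- by move=> ax ay; have := XM _ _ ax ay; rewrite !mulgA mulgVK.
- by move=> /XV; rewrite !invMg invgK mulgA.
Qed.

(** The form $x^ax^{-b}$ is closed under products and inverses without a case analysis on signs. *)
Lemma expgzP (x y : G) :
  (exists m, y = expgz x m) <-> exists a b, y = x ^+ a * x ^- b.
Proof.
split=> [[[a|a] ->]|[a [b ->]]].
- by exists a, 0%N; rewrite invg1 mulg1.
- by exists 0%N, a.+1; rewrite mul1g.
have [ba|ab] := leqP b a.
  by exists (Posz (a - b)); rewrite /= expgnFr.
exists (Negz (b - a).-1) => /=.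
have -> : (b - a).-1.+1 = (b - a)%N by lia.
by rewrite expgnFr 1?ltnW // invMg invgK.
Qed.

Lemma gen_subgroup1P (x y : G) :
  gen_subgroup (set1 x) y <-> exists m, y = expgz x m.
Proof.
have [x1 xM xV] := gen_subgroupP (set1 x).
have xx : gen_subgroup (set1 x) x by apply: gen_subgroup_in.
have xX k : gen_subgroup (set1 x) (x ^+ k).
  by elim: k => [|k IHk]; [exact: x1 | rewrite expgS; apply: xM].
split=> [|/expgzP[a [b ->]]]; last by apply: xM => //; apply: xV.
move=> xy; apply/expgzP; move: y xy; apply: gen_subgroup_min; last first.
  by move=> _ ->; exists 1%N, 0%N; rewrite invg1 mulg1.
have cx a b : commute (x ^+ a) (x ^- b) by apply/commuteV/commuteX2.
split=> [|_ _ [a [b ->]] [c [d ->]]|_ [a [b ->]]].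
- by exists 0%N, 0%N; rewrite mulgV.
- exists (a + c)%N, (d + b)%N.
  rewrite !expgnDr invMg -!mulgA; congr (_ * _).
  by rewrite mulgA -cx -mulgA; congr (_ * _); rewrite -!invMg -!expgnDr addnC.
- by exists b, a; rewrite invMg invgK.
Qed.

Lemma artin_conj k (s x : nat -> G) H i j : artin_rels k s x -> subgroup H ->
  (forall l, (l < k)%N -> H (x l)) -> (i < k)%N -> (j.+1 < k)%N ->
  H (s j * x i * (s j)^-1) /\ H ((s j)^-1 * x i * s j).
Proof.
move=> [r1 r2 r3] [H1 HM HV] Hx ik jk.
case: (eqVneq j i) => [ji|ji].
  subst i; have := r1 _ jk; have := r3 _ jk; rewrite /commute => e3 e1.
  split; first by rewrite e1 mulgK; apply: Hx.
  have -> : (s j)^-1 * x j * s j = (x j)^-1 * x j.+1 * x j.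
    have eV : s j * (x j)^-1 = (x j.+1)^-1 * s j.
      by apply: (mulgI (x j.+1)); rewrite mulVKg mulgA -e1 mulgK.
    apply: (mulgI (s j)); rewrite !mulgA mulgV mul1g eV -!mulgA e3.
    by rewrite -!mulgA mulKg.
  by do !apply: (HM) => //; [apply: HV|..]; apply: Hx.
case: (eqVneq j.+1 i) => [ji1|ji1].
  subst i; have := r1 _ jk; have := r3 _ jk; rewrite /commute => e3 e1.
  split; last by rewrite -mulgA -e1 mulKg; apply: Hx; lia.
  have -> : s j * x j.+1 * (s j)^-1 = x j.+1 * x j * (x j.+1)^-1.
    apply: (mulIg (s j)); rewrite mulgVK -mulgA.
    apply: (mulIg (x j)); rewrite -mulgA e3.
    by rewrite -!mulgA e1 mulKg.
  by apply: (HM); [apply: (HM)|apply: HV]; apply: Hx; lia.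
have e := r2 _ _ ik jk ji ji1; rewrite e mulgK; split; first exact: Hx.
by rewrite -mulgA -e mulKg; apply: Hx.
Qed.

Variables (K : nat) (g : nat -> G).
Hypothesis gK : braid_seq K g.
Local Notation E p := (dn g p (K - p)).

Lemma sweepS p : (p < K)%N -> E p = E p.+1 * g p.
Proof. by move=> pK; rewrite -dnSr; congr dn; lia. Qed.

Lemma sweep_lt j p : (p < j < K)%N -> E p * g j = g j.-1 * E p.
Proof. by case: j => [|j] // pj; rewrite (dn_shift gK) //; lia. Qed.

Lemma sweep_gt j p : (j.+1 < p <= K)%N -> commute (g j) (E p).
Proof. by move=> pj; apply: commute_dn => i hi; apply: (braid_seq_far gK); lia. Qed.

End Subgroups.

(* The tracked strand passes behind the strands K, ..., p+1, encircles the    *)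
(* strand at position p and comes back.                                       *)
HB.lock Definition loop (G : groupType) (K : nat) (g : nat -> G) (p : nat) : G :=
  dn g p.+1 (K - p.+1) * ((g p)^-1 * (g p)^-1) * (dn g p.+1 (K - p.+1))^-1.

Section Loops.
Variables (G : groupType) (K : nat) (g : nat -> G).
Hypothesis gK : braid_seq K g.
Local Notation E p := (dn g p (K - p)).
Local Notation A := (loop K g).

Lemma loopE p : A p = E p.+1 * ((g p)^-1 * (g p)^-1) * (E p.+1)^-1.
Proof. by rewrite unlock. Qed.

Lemma loop_conj p : A p = ((g p)^-1 * (g p)^-1) ^ (E p.+1)^-1.
Proof. by rewrite loopE conjgE invgK !mulgA. Qed.

Lemma loop_artin : artin_rels K g A.
Proof.
(* Conjugation by [E i.+2] fixes [g i] and reduces the relations between neighbouring loops to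
   identities in [g i] and [g i.+1]. *)
have pair i : (i.+1 < K)%N -> let D := (E i.+2)^-1 in
  [/\ g i = g i ^ D,
      A i = (g i.+1 * ((g i)^-1 * (g i)^-1) * (g i.+1)^-1) ^ D
    & A i.+1 = ((g i.+1)^-1 * (g i.+1)^-1) ^ D].
  move=> iK D; split; last exact: loop_conj.
    have c : commute (g i) (E i.+2) by apply: (sweep_gt gK); lia.
    by rewrite conjgE invgK mulgA -c mulgK.
  rewrite loop_conj (sweepS _ iK) invMg conjgM; congr (_ ^ _).
  by rewrite conjgE invgK !mulgA.
split=> [i iK|i j iK jK ji jSi|i iK].
- have [e1 e2 e3] := pair i iK; rewrite e2 e3 {1 4}e1 -!conjMg; congr (_ ^ _).
  have b := braid_seqS gK iK.
  have h : g i * g i.+1 * (g i)^-1 = (g i.+1)^-1 * (g i * g i.+1).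
    by apply: (mulgI (g i.+1)); apply: (mulIg (g i)); rewrite mulVKg !mulgA mulgVK -b.
  rewrite !mulgA h -!mulgA (mulgA (g i)) (mulgA (g i * _)) h.
  by rewrite -!mulgA mulgV mulg1.
- have [ij|ij] := ltnP i j.
    have e : g j = g j.+1 ^ (E i.+1)^-1.
      have h : E i.+1 * g j.+1 = g j * E i.+1.
        by rewrite (sweep_lt gK) //; lia.
      by rewrite conjgE invgK mulgA h mulgK.
    rewrite loop_conj /commute e -!conjMg; congr (_ ^ _).
    have c : commute (g j.+1) (g i)^-1.
      by apply/commuteV/commute_sym/(braid_seq_far gK); lia.
    exact: commuteM.
  have c : commute (g j) (E i.+1) by apply: (sweep_gt gK); lia.
  have c' : commute (g j) (g i)^-1 by apply/commuteV/(braid_seq_far gK); lia.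
  rewrite loopE; apply: commuteM; last exact: commuteV.
  by apply: commuteM => //; apply: commuteM.
have [e1 e2 e3] := pair i iK; rewrite e2 e3 {1}e1 -!conjMg /commute -!conjMg.
congr (_ ^ _).
have -> : (g i.+1)^-1 * (g i.+1)^-1 * (g i.+1 * ((g i)^-1 * (g i)^-1) * (g i.+1)^-1) =
    (g i.+1 * (g i * g i) * g i.+1)^-1.
  by rewrite !invMg !mulgA mulgVK.
apply: commuteV; have b := braid_seqS gK iK; rewrite /commute.
by rewrite !mulgA b -!mulgA; congr (_ * (_ * _)); rewrite !mulgA -b.
Qed.

End Loops.

(** * Forgetting the last strand *)

(** A letter away from the tracked strand has the same renumbered index [k] whether it is pushed
    through the sweep or recorded by the action; both invariants, [loops_decomp] and
    [s_braid_track], rest on this. *)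
Lemma sweep_letter n j p : (j < n.-1)%N -> (p < n)%N -> p != j -> p != j.+1 ->
  let E := dn (gen n) p (n.-1 - p) in
  exists2 k, (k < n.-2)%N &
    [/\ gen n j * E^-1 = E^-1 * gen n k, (gen n j)^-1 * E^-1 = E^-1 * (gen n k)^-1
      & forall (G : groupType) (s x : nat -> G) c,
          track_fun n s x j (p, c) = (p, s k * c) /\
          track_inv n s x j (p, c) = (p, (s k)^-1 * c)].
Proof.
move=> jn pn pj pj1 E; have gB := gen_braid_seq n.
have [k kn [ek et]] : exists2 k, (k < n.-2)%N & gen n j * E^-1 = E^-1 * gen n k /\
    forall (G : groupType) (s x : nat -> G) c,
      track_fun n s x j (p, c) = (p, s k * c) /\
      track_inv n s x j (p, c) = (p, (s k)^-1 * c).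
  rewrite /track_fun /track_inv (negPf pj) (negPf pj1) pn /E.
  have [pl|pl] := ltnP p j.
    exists j.-1; [lia | split=> //].
    apply: (mulgI E); apply: (mulIg E).
    by rewrite mulVKg !mulgA mulgVK sweep_lt //; lia.
  exists j; [lia | split=> //].
  by apply: commuteV; apply: (sweep_gt gB); lia.
exists k => //; split=> //.
by apply: (mulgI (gen n j)); rewrite mulVKg mulgA ek mulgK.
Qed.

Lemma artin_rels1 k (G : groupType) (s : nat -> G) : artin_rels k s (fun=> 1).
Proof. by split=> *; rewrite /commute !(mulg1, mul1g). Qed.

Section ForgetLast.
Variable n : nat.
Hypothesis n1 : (1 < n)%N.
Local Notation g := (gen n).
Local Notation E p := (dn (gen n) p (n.-1 - p)).
Local Notation A := (loop n.-1 (gen n)).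

Definition loops : set (braid n) := gen_subgroup [set b | exists2 i, (i < n.-1)%N & b = A i].

Lemma loops_in i : (i < n.-1)%N -> loops (A i).
Proof. by move=> iN; apply: gen_subgroup_in; exists i. Qed.

Lemma loops_conj j : (j < n.-2)%N -> forall b, loops b ->
  loops (g j * b * (g j)^-1) /\ loops ((g j)^-1 * b * g j).
Proof.
move=> jn b Lb.
have H i : (i < n.-1)%N -> loops (g j * A i * (g j)^-1) /\ loops ((g j)^-1 * A i * g j).
  move=> iN; apply: (artin_conj (loop_artin (gen_braid_seq n))) => //; last lia.
    exact: gen_subgroupP.
  exact: loops_in.
split; first by move: b Lb; apply: subgroup_conj => _ [i iN ->]; case: (H i iN).
rewrite -{2}[g j]invgK; move: b Lb; apply: subgroup_conj => _ [i iN ->].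
by rewrite invgK; case: (H i iN).
Qed.

Lemma pure_loop i : (i < n.-1)%N -> pure_braid (A i).
Proof.
move=> iN; rewrite loopE; apply: pure_conj; rewrite /pure_braid /= braid_permM.
by rewrite braid_perm_genV // -{1}braid_perm_genV // braid_permV mulVg.
Qed.

Lemma pure_loops b : loops b -> pure_braid b.
Proof.
move: b; apply: gen_subgroup_min; first exact: pure_subgroup.
by move=> _ [i iN ->]; exact: pure_loop.
Qed.

Definition forget : braid n -> braid n.-1 := cocycle (gen n.-1) (fun=> 1).

Let fR := gen_braid_seq n.-1.
Let f1 := artin_rels1 n.-1 (gen n.-1).

Lemma sweep_last : E n.-1 = 1. Proof. by rewrite subnn. Qed.

(* Pushing the tracked strand behind all the others turns a braid into one of *)
(* the first n-1 strands; each passage in front costs a loop. *)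
Lemma loops_decomp b : exists2 a, loops a &
  let q := track (gen n.-1) (fun=> 1) b (n.-1, 1) in
  b = (E q.1)^-1 * a * iota_braid q.2 /\ (q.1 < n)%N.
Proof.
have [L1 LM LV] : subgroup loops by exact: gen_subgroupP.
elim/braid_ind: b => [|j b jn [a La]|j b jn [a La]].
- by exists 1 => //; rewrite track1 //= sweep_last iota_braid1 invg1 !mulg1; split=> //; lia.
- rewrite trackE // track_genE //; case: (track _ _ b _) => p c /= [-> pn].
  case: (eqVneq p j.+1) => [pj|pj].
    subst p; rewrite track_fun_lo invg1 mul1g /=.
    exists ((A j)^-1 * a); first exact: LM (LV _ (loops_in jn)) La.
    split; last lia.
    rewrite loopE (sweepS g jn) !invMg !invgK -!mulgA mulKg.
    by rewrite mulKg.
  case: (eqVneq p j) => [pj'|pj'].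
    subst p; rewrite track_fun_hi /=; exists a => //; split; last lia.
    by rewrite (sweepS g jn) invMg !mulgA mulgV mul1g.
  have [k kn [ek _ /(_ _ (gen n.-1) (fun=> 1) c)[eg _]]] := sweep_letter jn pn pj' pj.
  rewrite eg /= iota_braidM iota_gen //.
  exists (g k * a * (g k)^-1); first by case: (loops_conj kn La).
  by rewrite !mulgA ek mulgVK.
- rewrite trackE // track_genV //; case: (track _ _ b _) => p c /= [-> pn].
  case: (eqVneq p j) => [pj|pj].
    subst p; rewrite /track_inv eqxx mul1g /=.
    exists (A j * a); first exact: LM (loops_in jn) La.
    split; last lia.
    rewrite loopE (sweepS g jn) !invMg -!mulgA mulKg.
    by [].
  case: (eqVneq p j.+1) => [pj'|pj'].
    subst p; rewrite /track_inv eqxx (negPf pj) /=; exists a => //; split; last lia.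
    by rewrite (sweepS g jn) invMg !mulgA.
  have [k kn [_ ek /(_ _ (gen n.-1) (fun=> 1) c)[_ eg]]] := sweep_letter jn pn pj pj'.
  rewrite eg /= iota_braidM iota_braidV iota_gen //.
  exists ((g k)^-1 * a * g k); first by case: (loops_conj kn La).
  by rewrite !mulgA ek mulgK.
Qed.

Lemma forget_decomp b : pure_braid b -> exists2 a, loops a & b = a * iota_braid (forget b).
Proof.
move=> bP; have [a La [e _]] := loops_decomp b; exists a => //.
rewrite {1}e track_pure //; last lia.
by rewrite sweep_last invg1 mul1g.
Qed.

Lemma pure_forget b : pure_braid b -> pure_braid (forget b).
Proof.
move=> bP; have [a /pure_loops La e] := forget_decomp bP.
apply/pure_iota; have [_ pM pV] := @pure_subgroup n.
have -> : iota_braid (forget b) = a^-1 * b by rewrite {2}e mulKg.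
by apply: pM => //; apply: pV.
Qed.

Lemma forget_iota c : forget (iota_braid c) = c.
Proof. by rewrite /forget cocycle_iota // braid_lift_gen. Qed.

Lemma forgetM a b : pure_braid a -> pure_braid b -> forget (a * b) = forget a * forget b.
Proof. by move=> aP bP; apply: cocycleM => //; lia. Qed.

Lemma forgetV a : pure_braid a -> forget a^-1 = (forget a)^-1.
Proof. by move=> aP; apply: cocycleV => //; lia. Qed.

(** In $d_n=\iota(d_{n-1})r_n$ the last flip moves only the forgotten strand. *)
Lemma forget_full_twist : forget (full_twist n) = full_twist n.-1.
Proof.
have dP : pure_braid (iota_braid (full_twist n.-1) : braid n).
  by apply/pure_iota/pure_full_twist; lia.
have rP : pure_braid (flip n n.-1) by apply: pure_flip; lia.
rewrite iota_full_twist // forgetM // forget_iota /forget (cocycle_flip_last fR f1) //; last lia.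
have dn1 k : dn (fun=> 1 : braid n.-1) 0 k = 1.
  by elim: k => //= k ->; rewrite mulg1.
by rewrite dn1 invg1 mulg1.
Qed.

End ForgetLast.

(** * Reduced words and Hurwitz moves *)

Section ReducedWords.
Variable n : nat.
Implicit Types (l : letter n) (u w : bword n).

Definition reduced w : bool := sorted (fun a b : letter n => b != inv_letter a) w.

Definition push l w : bword n :=
  if w is a :: w' then if a == inv_letter l then w' else l :: w else [:: l].

Lemma push_reduced l w : reduced w -> reduced (push l w).
Proof.
case: w => [//|a w] /= aw; case: eqP => [_|/eqP al]; first exact: path_sorted aw.
by rewrite /= al.
Qed.

Lemma pushK l w : reduced w -> push (inv_letter l) (push l w) = w.
Proof.
case: w => [|a w] /=; first by rewrite inv_letterK eqxx.
case: eqP => [->|_ _ /=]; last by rewrite inv_letterK eqxx.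
case: w => [//|b w] /= /andP[bl _].
by rewrite (negPf bl).
Qed.

Lemma foldr_push_reduced u w : reduced w -> reduced (foldr push w u).
Proof. by move=> ww; elim: u => //= l u; exact: push_reduced. Qed.

Lemma foldr_push_id u : reduced u -> foldr push [::] u = u.
Proof.
elim: u => [//|l u IHu] lu; rewrite /= IHu; last exact: path_sorted lu.
by case: u lu {IHu} => [//|a u] /= /andP[/negPf-> _].
Qed.

Lemma eval_cons (G : groupType) (f : 'I_n.-1 -> G) l w :
  eval f (l :: w) = (if l.2 then f l.1 else (f l.1)^-1) * eval f w.
Proof. by rewrite /eval big_cons. Qed.

Lemma eval_push (G : groupType) (f : 'I_n.-1 -> G) l w :
  eval f (push l w) = eval f (l :: w).
Proof.
case: w => [//|a w] /=; case: eqP => [->|//].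
by rewrite !eval_cons /inv_letter /=; case: l.2; rewrite /= ?mulVKg ?mulKg.
Qed.

Lemma eval_foldr_push (G : groupType) (f : 'I_n.-1 -> G) u :
  eval f (foldr push [::] u) = eval f u.
Proof. by elim: u => //= l u IHu; rewrite eval_push !eval_cons IHu. Qed.

Lemma eval_inv_word (G : groupType) (f : 'I_n.-1 -> G) u :
  eval f (inv_word u) = (eval f u)^-1.
Proof.
elim: u => [|l u IHu]; first by rewrite /eval !big_nil invg1.
rewrite /inv_word /= rev_cons -cats1 eval_cat -/(inv_word u) IHu !eval_cons.
rewrite invMg; congr (_ * _); rewrite /eval big_nil mulg1.
by case: l => i [] //=; rewrite invgK.
Qed.

Lemma gen_subgroup_eval (G : groupType) (f : 'I_n.-1 -> G) y :
  gen_subgroup [set f i | i in setT] y -> exists u, y = eval f u.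
Proof.
move: y; apply: gen_subgroup_min; last first.
  by move=> _ [i _ <-]; exists [:: (i, true)]; rewrite eval_cons /= /eval big_nil mulg1.
split=> [|_ _ [u ->] [v ->]|_ [u ->]].
- by exists [::]; rewrite /eval big_nil.
- by exists (u ++ v); rewrite eval_cat.
- by exists (inv_word u); rewrite eval_inv_word.
Qed.

Definition rword := {w : bword n | reduced w}.

Definition rpush l (w : rword) : rword := Sub (push l (val w)) (push_reduced l (valP w)).

Lemma rpushK l : cancel (rpush l) (rpush (inv_letter l)).
Proof. by move=> w; apply: val_inj; rewrite /= pushK ?(valP w). Qed.

Lemma rpushVK l : cancel (rpush (inv_letter l)) (rpush l).
Proof. by move=> w; have := rpushK (inv_letter l) w; rewrite inv_letterK. Qed.

(** The regular action of the free group on its reduced words: applied to the empty word, a reduced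
    word returns itself ([foldr_push_id]). *)
Definition free_act (i : 'I_n.-1) : bijection rword :=
  Bijection (rpushK (i, true)) (rpushVK (i, true)).

Lemma eval_free_act u (w : rword) : val (eval free_act u w) = foldr push (val w) u.
Proof.
elim: u => [|l u IHu]; first by rewrite /eval big_nil.
by rewrite eval_cons bfunM /= -IHu; case: l => i [].
Qed.

End ReducedWords.

Section Hurwitz.
Variables (T : Type).
Implicit Types (h : nat -> bijection T).

(** A Hurwitz move: it changes two neighbouring entries and preserves their product $h_{i+1}h_i$. *)
Definition hurwitz (i : nat) h : nat -> bijection T := fun t =>
  if t == i then (h i)^-1 * h i.+1 * h i else if t == i.+1 then h i else h t.

Definition hurwitzV (i : nat) h : nat -> bijection T := fun t =>
  if t == i then h i.+1 else if t == i.+1 then h i.+1 * h i * (h i.+1)^-1 else h t.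

Lemma hurwitzK i : cancel (hurwitz i) (hurwitzV i).
Proof.
move=> h; apply/funext => t; rewrite /hurwitzV /hurwitz !eqxx.
have -> : (i.+1 == i) = false by lia.
case: eqP => [-> //|_]; case: eqP => [->|//].
by rewrite !mulgA mulgV mul1g mulgK.
Qed.

Lemma hurwitzVK i : cancel (hurwitzV i) (hurwitz i).
Proof.
move=> h; apply/funext => t; rewrite /hurwitzV /hurwitz !eqxx.
have -> : (i.+1 == i) = false by lia.
case: eqP => [->|_]; last by case: eqP => [->|].
by rewrite !mulgA mulVg mul1g mulgVK.
Qed.

Local Notation Q := ((nat -> bijection T) * T)%type.

Lemma hurwitz_sK i : cancel (fun q : Q => (hurwitz i q.1, q.2))
  (fun q => (hurwitzV i q.1, q.2)).
Proof. by case=> h z; rewrite /= hurwitzK. Qed.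

Lemma hurwitz_sVK i : cancel (fun q : Q => (hurwitzV i q.1, q.2))
  (fun q => (hurwitz i q.1, q.2)).
Proof. by case=> h z; rewrite /= hurwitzVK. Qed.

Lemma hurwitz_xK i : cancel (fun q : Q => (q.1, q.1 i q.2))
  (fun q => (q.1, (q.1 i)^-1 q.2)).
Proof. by case=> h z; rewrite /= bfunK. Qed.

Lemma hurwitz_xVK i : cancel (fun q : Q => (q.1, (q.1 i)^-1 q.2))
  (fun q => (q.1, q.1 i q.2)).
Proof. by case=> h z; rewrite /= binvK. Qed.

Definition hurwitz_s (i : nat) : bijection Q := Bijection (hurwitz_sK i) (hurwitz_sVK i).
Definition hurwitz_x (i : nat) : bijection Q := Bijection (hurwitz_xK i) (hurwitz_xVK i).

Lemma hurwitz_braid_seq k : braid_seq k hurwitz_s.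
Proof.
split=> [i _|i j /andP[ij _]]; apply: bijection_eq => -[h z]; congr (_, _);
  apply/funext => t; rewrite /= /hurwitz.
  have e1 : (i.+1 == i) = false by lia.
  have e2 : (i.+2 == i.+1) = false by lia.
  have e3 : (i.+2 == i) = false by lia.
  have e4 : (i == i.+1) = false by lia.
  have e5 : (i == i.+2) = false by lia.
  have e6 : (i.+1 == i.+2) = false by lia.
  rewrite !(eqxx, e1, e2, e3, e4, e5, e6) /=.
  have [t1|t1] := eqVneq t i; first by rewrite !t1 ?e4 ?e5 /= !invMg invgK !mulgA !mulgK.
  by have [t2|t2] := eqVneq t i.+1; [rewrite ?t2 ?e6 | case: eqP].
have e1 : (i == j) = false by lia.
have e2 : (i == j.+1) = false by lia.
have e3 : (i.+1 == j) = false by lia.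
have e4 : (i.+1 == j.+1) = false by lia.
have e5 : (j == i) = false by lia.
have e6 : (j == i.+1) = false by lia.
have e7 : (j.+1 == i) = false by lia.
have e8 : (j.+1 == i.+1) = false by lia.
rewrite !(eqxx, e1, e2, e3, e4, e5, e6, e7, e8) /=.
have [t1|t1] := eqVneq t i; first by rewrite ?t1 ?(e1, e2).
have [t2|t2] := eqVneq t i.+1; first by rewrite ?t2 ?(e3, e4).
by [].
Qed.

Lemma hurwitz_artin k : artin_rels k hurwitz_s hurwitz_x.
Proof.
split=> [i _|i j _ _ ji jSi|i _]; apply: bijection_eq => -[h z]; congr (_, _);
  rewrite /= /hurwitz ?eqxx.
- by rewrite ifN //; lia.
- by rewrite !ifN // eq_sym.
- rewrite ifN; last lia.
  by rewrite !bfunM bfunKV.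
Qed.

(** The [hurwitz_x] leave the tuple unchanged, so a word in them evaluates at whatever bijections
    the tuple contains. This makes the relations of [hurwitz_artin] as free as the chosen tuple. *)
Lemma eval_hurwitz_x n (u : bword n) h z :
  eval (fun i : 'I_n.-1 => hurwitz_x i) u (h, z) =
  (h, eval (fun i : 'I_n.-1 => h i) u z).
Proof.
elim: u => [|l u IHu]; first by rewrite /eval !big_nil.
by rewrite !eval_cons !bfunM IHu; case: l.2.
Qed.

End Hurwitz.

(** * The center of the pure braid group *)

(** Of all the letters of the loop only the second [(g p)^-1] makes the tracked strand pass in
    front. *)
Lemma cocycle_loop n (G : groupType) (s x : nat -> G) p :
  braid_seq n.-2 s -> artin_rels n.-1 s x -> (p < n.-1)%N ->
  cocycle s x (loop n.-1 (gen n) p) = x p.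
Proof.
move=> sB sx pn; rewrite /cocycle loopE !trackE //.
have hd h : track s x (dn (gen n) p.+1 (n.-1 - p.+1)) (p.+1, h) = (n.-1, h).
  by rewrite track_dn //; [congr (_, _) |]; lia.
have hV : track s x (dn (gen n) p.+1 (n.-1 - p.+1))^-1 (n.-1, 1) = (p.+1, 1).
  by rewrite trackV // -(hd 1) bfunVK.
rewrite hV !track_genV //.
have -> : track_inv n s x p (p.+1, 1) = (p, 1).
  by rewrite /track_inv eqxx ifN //; lia.
by rewrite /track_inv eqxx hd /= mulg1.
Qed.

Lemma cocycle_eval n (G : groupType) (s x : nat -> G) (u : bword n) :
  (0 < n)%N -> braid_seq n.-2 s -> artin_rels n.-1 s x ->
  let y := eval (fun i : 'I_n.-1 => loop n.-1 (gen n) i) u in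
  cocycle s x y = eval (fun i : 'I_n.-1 => x i) u /\ pure_braid y.
Proof.
move=> n0 sB sx /=; have [p1 pM pV] := @pure_subgroup n.
elim: u => [|[i e] u [IHu uP]].
  by rewrite /eval !big_nil; split=> //; rewrite /cocycle track1.
have iP : pure_braid (loop n.-1 (gen n) i) by apply: pure_loop.
rewrite !eval_cons /=; split; last by apply: pM => //; case: e => //; apply: pV.
rewrite cocycleM // ?IHu; last by case: e => //; apply: pV.
by congr (_ * _); case: e; rewrite ?cocycleV // cocycle_loop.
Qed.

Lemma loops_eval n b : loops b ->
  exists u : bword n, b = eval (fun i : 'I_n.-1 => loop n.-1 (gen n) i) u.
Proof.
move=> Lb; apply: gen_subgroup_eval.
move: b Lb; apply: gen_subgroup_min; first exact: gen_subgroupP.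
by move=> _ [i iN ->]; apply: gen_subgroup_in; exists (Ordinal iN).
Qed.

(* Evaluating in the Hurwitz action at the regular action of the free group   *)
(* recovers the reduced word of an element of [loops].                         *)
Lemma loops_center n (b : braid n) : (2 < n)%N -> loops b ->
  (forall i, (i < n.-1)%N -> commute b (loop n.-1 (gen n) i)) -> b = 1.
Proof.
move=> n2 /loops_eval[u0 ->].
rewrite -eval_foldr_push; have := foldr_push_reduced u0 (isT : reduced [::]).
move: (foldr _ _ _) => {u0}u ru bA.
case: u ru bA => [|a u] ru bA; first by rewrite /eval big_nil.
have [i ia] : exists i : 'I_n.-1, i != a.1.
  case: (posnP a.1) => a0; last first.
    have i0 : (0 < n.-1)%N by lia.
    by exists (Ordinal i0); rewrite -val_eqE /=; lia.
  have i1 : (1 < n.-1)%N by lia.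
  by exists (Ordinal i1); rewrite -val_eqE /= a0.
(* With the sign of the last letter, [c] cannot cancel at the right end; with a generator other than
   that of [a], it cannot cancel at the left end. Both words in [e1] are thus reduced, but their
   first letters differ. *)
pose c : letter n := (i, (last a u).2).
have rc : reduced ((a :: u) ++ [:: c]).
  rewrite /reduced cat_cons /= cat_path; apply/andP; split=> //=.
  rewrite andbT; apply/eqP => /(congr1 snd) /=; by case: (_.2).
pose x := hurwitz_x (rword n).
have sB := hurwitz_braid_seq (rword n) n.-2.
have sx := hurwitz_artin (rword n) n.-1.
pose f (i : 'I_n.-1) := loop n.-1 (gen n) i.
have e1 : eval f ((a :: u) ++ [:: c]) = eval f (c :: a :: u).
  rewrite eval_cat (eval_cons f c (a :: u)) (eval_cons f c [::]).
  have -> : eval f [::] = 1 by rewrite /eval big_nil.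
  rewrite mulg1.
  by case: c.2; [|apply: commuteV]; apply: bA.
have := congr1 (cocycle (hurwitz_s (rword n)) x) e1.
have n0 : (0 < n)%N by lia.
rewrite !(cocycle_eval _ n0 sB sx).1.
pose h (t : nat) : bijection (rword n) := oapp (@free_act n) 1 (insub t).
pose w0 : rword n := Sub [::] (isT : reduced [::]).
move=> /(congr1 (fun F : bijection _ => F (h, w0))).
rewrite !eval_hurwitz_x => -[].
have -> : (fun i0 : 'I_n.-1 => h i0) = @free_act n.
  by apply/funext => j; rewrite /h valK.
move=> /(congr1 val); rewrite !eval_free_act foldr_push_id // foldr_push_id.
  by move=> /(congr1 (head a)) /= ac; move: ia; rewrite ac eqxx.
rewrite /reduced /=; apply/andP; split=> //.
by apply/eqP => /(congr1 fst) /= e; move: ia; rewrite e eqxx.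
Qed.

Lemma loops_central n (a : braid n.+2) : loops a ->
  (forall b, pure_braid b -> commute a b) -> gen_subgroup (set1 (full_twist n.+2)) a.
Proof.
case: n a => [|n] a La aC; last first.
  have -> : a = 1; last by case: (gen_subgroupP (set1 (full_twist n.+3))).
  by apply: loops_center => // i iN; apply/aC/pure_loop.
move: a La {aC}; apply: gen_subgroup_min; first exact: gen_subgroupP.
(* On two strands the only loop is $\sigma_1^{-2}=d_2^{-1}$. *)
move=> _ [[|//] _ ->]; rewrite loopE /= invg1 mulg1 mul1g -invMg.
have [_ _] := gen_subgroupP (set1 (full_twist 2)); apply.
by apply: gen_subgroup_in; rewrite full_twistE /= expg2 addn0 mulg1.
Qed.

Lemma center_pure_braid n : (0 < n)%N ->
  center (@pure_braid n) = gen_subgroup (set1 (full_twist n)).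
Proof.
case: n => [//|n _]; apply/seteqP; split=> [x|]; last first.
  apply: gen_subgroup_min => [|_ ->]; last first.
    split; first exact: pure_full_twist.
    by move=> y _; apply: full_twist_central.
  have [p1 pM pV] := @pure_subgroup n.+1.
  split=> [|x y [xP xC] [yP yC]|x [xP xC]].
  - by split=> // y _; rewrite mulg1 mul1g.
  - split; first exact: pM.
    by move=> z zP; apply/commute_sym/commuteM; apply/commute_sym; [exact: xC | exact: yC].
  - split; first exact: pV.
    by move=> z zP; apply/commute_sym/commuteV/commute_sym/xC.
elim: n x => [|n IHn] x [xP xC].
  have -> : x = 1; last by case: (gen_subgroupP (set1 (full_twist 1))).
  by elim/braid_ind: x {xP xC}.
set N := n.+2 in x xP xC *; have N1 : (1 < N)%N by [].
have [d1 dM dV] := gen_subgroupP (set1 (full_twist N)).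
have [p1 pM pV] := @pure_subgroup N.
have dP z : gen_subgroup (set1 (full_twist N)) z -> pure_braid z.
  by move: z; apply: gen_subgroup_min => [|_ ->]; [exact: pure_subgroup | exact: pure_full_twist].
have dC z : gen_subgroup (set1 (full_twist N)) z -> forall b, commute z b.
  move: z; apply: gen_subgroup_min => [|_ ->].
    split=> [b|y z yC zC b|y yC b]; apply/commute_sym; first exact: commute1.
      by apply: commuteM; apply/commute_sym.
    exact/commuteV/commute_sym/yC.
  by move=> b; apply: full_twist_central.
(* The map [forget] is onto $P_{n-1}$, with section $\iota$, so it preserves centrality. *)
have fx : gen_subgroup (set1 (full_twist n.+1)) (forget x : braid n.+1).
  apply: IHn; split; first exact: (pure_forget N1 xP).
  move=> c cP; have icP : pure_braid (@iota_braid N c) by apply/(@pure_iota N).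
  have fc := @forget_iota N N1 c.
  by rewrite -fc -(forgetM N1 xP icP) -(forgetM N1 icP xP) xC.
have [z dz fz] : exists2 z, gen_subgroup (set1 (full_twist N)) z & forget z = forget x.
  move: (forget x : braid n.+1) fx; apply: gen_subgroup_min; last first.
    by move=> _ ->; exists (full_twist N); [apply: gen_subgroup_in | exact: forget_full_twist].
  split=> [|_ _ [y dy <-] [z dz <-]|_ [y dy <-]].
  - by exists 1 => //; rewrite -(iota_braid1 N) forget_iota.
  - by exists (y * z); [apply: dM | rewrite forgetM //; apply: dP].
  - by exists y^-1; [apply: dV | rewrite forgetV //; apply: dP].
have zP := dP z dz.
have yP : pure_braid (x * z^-1) by apply: pM => //; apply: pV.
have yC b : pure_braid b -> commute (x * z^-1) b.
  move=> bP; apply/commute_sym/commuteM; first by apply/commute_sym/xC.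
  by apply/commuteV/commute_sym/dC.
have fy : forget (x * z^-1) = 1.
  by rewrite forgetM // ?forgetV // ?fz ?mulgV //; apply: pV.
have [a La] := forget_decomp N1 yP; rewrite fy iota_braid1 mulg1 => ya.
suff dy : gen_subgroup (set1 (full_twist N)) (x * z^-1).
  by rewrite -(mulgVK z x); apply: dM.
rewrite ya; apply: loops_central => // b bP; rewrite -ya; exact: yC.
Qed.

(** * Straightening the last strand *)

Section FlipSweep.
Variables (G : groupType) (K : nat) (g : nat -> G).
Hypothesis gK : braid_seq K g.
Local Notation E p := (dn g p (K - p)).

Lemma dn_up_shift a l : (a.+1 + l <= K)%N -> dn g a.+1 l * up g 0 K = up g 0 K * dn g a l.
Proof.
elim: l => [|l IHl] al /=; first by rewrite mul1g mulg1.
rewrite -mulgA IHl; last lia.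
by rewrite mulgA addSn (up_shift gK) ?mulgA //; lia.
Qed.

Lemma dn_dn_shift a k l : (l < k)%N -> (a + k <= K)%N ->
  dn g a k * dn g a.+1 l = dn g a l * dn g a k.
Proof.
elim: l => [|l IHl] al ak /=; first by rewrite mul1g mulg1.
rewrite mulgA addSn -(dn_shift gK); [|lia|lia].
by rewrite -!mulgA IHl //; lia.
Qed.

(** Trades a flip on [K.+1] strands for one on [K] strands and a double crossing, which turns a
    passage in front into one behind. *)
Lemma flip_sweep j : (j < K)%N ->
  E j.+1 * flip_seq K g j = flip_seq K.-1 g j * E j.+1 * g j * g j.
Proof.
move=> jK; rewrite !flip_seqE.
have c : commute (E j.+1) (dn g 0 j).
  apply: commute_dn => i hi; apply/commute_sym.
  by apply: (sweep_gt gK); lia.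
have Ej : E j = E j.+1 * g j by apply: sweepS.
have Ej' : E j = g K.-1 * dn g j (K.-1 - j).
  have -> : (K - j = (K.-1 - j).+1)%N by lia.
  by rewrite /=; congr (g _ * _); lia.
have UK : up g 0 K = up g 0 K.-1 * g K.-1.
  by case: (K) jK => [//|k] _ /=; rewrite add0n.
have sh : E j.+1 * up g 0 K = up g 0 K * dn g j (K.-1 - j).
  have -> : (K.-1 - j = K - j.+1)%N by lia.
  by apply: dn_up_shift; lia.
have dd : dn g j (K.-1 - j) * E j = E j * E j.+1.
  have -> : (K.-1 - j = K - j.+1)%N by lia.
  by rewrite dn_dn_shift //; lia.
rewrite !mulgA c -(mulgA _ (E j.+1) (up _ _ _)) sh.
rewrite -!mulgA; congr (_ * _).
rewrite (mulgA (E j.+1)) -Ej {1}UK -mulgA; congr (_ * _).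
by rewrite mulgA -Ej' mulgA dd -mulgA -Ej.
Qed.

End FlipSweep.

(** $s_j$ commutes with the pair $x_{j+1}x_j$ and with each of the other factors. *)
Lemma artin_prod_commute (G : groupType) k (s x : nat -> G) j :
  artin_rels k s x -> (j.+1 < k)%N -> commute (s j) (dn x 0 k).
Proof.
move=> [_ r2 r3] jk.
have -> : k = (j + (2 + (k - j.+2)))%N by lia.
rewrite !dnD /= !add0n addn0 mulg1 addn1 addn2.
apply: commuteM; [apply: commuteM|]; last 2 first.
- exact: r3.
- by apply: commute_dn => i hi; apply: r2; lia.
by apply: commute_dn => i hi; apply: r2; lia.
Qed.

Lemma flip_gen_artin n : (0 < n)%N -> artin_rels n (gen n) (flip_seq n.-1 (gen n)).
Proof.
by case: n => [//|n] _; exact: flip_seq_artin (gen_braid_seq n.+1).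
Qed.

Section Unplait.
Variable n : nat.
Hypothesis n1 : (1 < n)%N.
Local Notation g := (gen n).
Local Notation E p := (dn (gen n) p (n.-1 - p)).
Local Notation R := (@trivial_subgroup n).
Local Notation D := (gen_subgroup (set1 (full_twist n.-1))).
Local Notation x := (flip_seq n.-2 (gen n.-1)).

Let sB : braid_seq n.-2 (gen n.-1) := gen_braid_seq n.-1.
Let sx : artin_rels n.-1 (gen n.-1) x.
Proof. by apply: flip_gen_artin; lia. Qed.
Let n0 : (0 < n)%N. Proof. lia. Qed.

Lemma iota_flip_seq p : (p < n.-1)%N ->
  iota_braid (flip_seq n.-2 (gen n.-1) p) = flip_seq n.-2 g p.
Proof.
by move=> pn; rewrite !flip_seqE !iota_braidM iota_up ?iota_dn //; lia.
Qed.

Lemma trivial_flip p : (p < n)%N -> R (flip n p).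
Proof. by move=> pn; apply: gen_subgroup_in; right; exists p. Qed.

Lemma trivial_full_twist : R (full_twist n).
Proof. by apply: gen_subgroup_in; left. Qed.

Lemma trivial_normal a b : R b -> R (a * b * a^-1).
Proof.
have [R1 RM RV] : subgroup R by exact: gen_subgroupP.
have H j i : (j < n.-1)%N -> (i < n)%N ->
    R (g j * flip n i * (g j)^-1) /\ R ((g j)^-1 * flip n i * g j).
  move=> jn iN; rewrite flipE //.
  apply: (artin_conj (flip_gen_artin n0)) => //; last lia.
  by move=> l ln; rewrite -flipE //; apply: trivial_flip.
have Hd y : y * full_twist n * y^-1 = full_twist n.
  by rewrite -(full_twist_central y n0) mulgK.
elim/braid_ind: a b => [|j a jn IHa|j a jn IHa] b Rb.
- by rewrite mul1g invg1 mulg1.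
- have -> : g j * a * b * (g j * a)^-1 = g j * (a * b * a^-1) * (g j)^-1.
    by rewrite invMg !mulgA.
  apply: subgroup_conj (IHa b Rb) => y [->|[i iN ->]]; first by rewrite Hd; exact: trivial_full_twist.
  by case: (H j i jn iN).
- have -> : (g j)^-1 * a * b * ((g j)^-1 * a)^-1 = (g j)^-1 * (a * b * a^-1) * (g j)^-1^-1.
    by rewrite !invMg !mulgA.
  apply: subgroup_conj (IHa b Rb) => y [->|[i iN ->]]; first by rewrite Hd; exact: trivial_full_twist.
  by rewrite invgK; case: (H j i jn iN).
Qed.

Lemma pure_trivial b : R b -> pure_braid b.
Proof.
move: b; apply: gen_subgroup_min; first exact: pure_subgroup.
by move=> _ [->|[p pn ->]]; [exact: pure_full_twist | exact: pure_flip].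
Qed.

(* The map [s] of the paper on pure braids, by [s_braidE] below. *)
Definition straighten : braid n -> braid n.-1 := cocycle (gen n.-1) x.

Lemma straighten_iota c : straighten (iota_braid c) = c.
Proof. by rewrite /straighten cocycle_iota // braid_lift_gen. Qed.

Lemma straightenM a b : pure_braid a -> pure_braid b ->
  straighten (a * b) = straighten a * straighten b.
Proof. by move=> aP bP; apply: cocycleM. Qed.

Lemma straightenV a : pure_braid a -> straighten a^-1 = (straighten a)^-1.
Proof. by move=> aP; apply: cocycleV. Qed.

(** Invariant of the reading: the modified word is a braid of the first $n-1$ strands followed by
    the last strand moving to position [q.1] behind the others. *)
Lemma s_braid_track (w : bword n) :
  let q := track (gen n.-1) x (cls w) (n.-1, 1) in
  [/\ tracked w = q.1, (q.1 < n)%N & s_braid w = (E q.1)^-1 * iota_braid q.2].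
Proof.
elim: w => [|[j e] w /= [IH1 IH2 IH3]].
  rewrite track1 //= subnn iota_braid1 invg1 mulg1; split=> //; lia.
have jn := ltn_ord j.
have flS : flip n j.+1 * g j = g j * flip n j.
  by rewrite !flipE ?flip_seqS //; lia.
have fl := flip_sweep (gen_braid_seq n) jn; rewrite -flipE in fl; last lia.
have fx := iota_flip_seq jn; rewrite -fx in fl.
have -> : cls ((j, e) :: w) = cls [:: (j, e)] * cls w by rewrite clsM.
rewrite braid_ofE /= IH3 trackE //; move: IH1 IH2; rewrite /insertion /=.
case: (track _ _ (cls w) _) => p c /= -> pn.
have ES := sweepS g jn.
case: e => /=.
  rewrite -[cls _]/(sigma j) -genE track_genE //.
  case: (eqVneq p j.+1) => [->|pj1].
    rewrite track_fun_lo /= ifN ?eqxx; last lia.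
    split=> //; first lia.
    rewrite iota_braidM iota_braidV !mulgA; congr (_ * _).
    have -> : (flip n j.+1)^-1 * g j = g j * (flip n j)^-1.
      by apply: (mulgI (flip n j.+1)); rewrite mulVKg mulgA flS mulgK.
    rewrite -mulgA -invMg fl ES !invMg !mulgA mulgV mul1g //.
  rewrite mul1g; case: (eqVneq p j) => [->|pj].
    rewrite track_fun_hi /= ; split=> //; first lia.
    by rewrite ES invMg !mulgA mulgV mul1g.
  have [k kn [ek _ /(_ _ (gen n.-1) x c)[-> _]]] := sweep_letter jn pn pj pj1.
  by split=> //=; rewrite iota_braidM iota_gen // !mulgA ek.
rewrite -[cls _](clsV [:: (j, true)]) -/(sigma j) -genE track_genV //.
case: (eqVneq p j) => [->|pj].
  rewrite /track_inv eqxx /=; split=> //; first lia.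
  rewrite iota_braidM !mulgA; congr (_ * _).
  move: (flip n j) fl {flS} => r fl.
  apply: (mulgI (E j.+1)); rewrite !mulgA fl mulgV mul1g ES invMg.
  by rewrite !mulgA mulgK mulgK mulgK.
rewrite mul1g; case: (eqVneq p j.+1) => [->|pj1].
  rewrite /track_inv eqxx ifN; last lia.
  by split=> //=; [lia | rewrite ES invMg !mulgA].
have [k kn [_ ek /(_ _ (gen n.-1) x c)[_ ->]]] := sweep_letter jn pn pj pj1.
by split=> //=; rewrite iota_braidM iota_braidV iota_gen // !mulgA ek.
Qed.

Lemma s_braidE (w : bword n) : pure_braid (cls w) ->
  s_braid w = iota_braid (straighten (cls w)).
Proof.
move=> wP; have [_ _ ->] := s_braid_track w.
by rewrite track_pure //; [rewrite subnn invg1 mul1g | lia].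
Qed.

(** By normality of $R_n$ the inserted flips can all be collected on the left. *)
Lemma s_braid_trivial (w : bword n) : exists2 r, R r & s_braid w = r * cls w.
Proof.
have [R1 RM RV] : subgroup R by exact: gen_subgroupP.
elim: w => [|[j e] w [r Rr IHw]]; first by exists 1 => //; rewrite mul1g.
have Ri : R (insertion (tracked w) (j, e)).
  rewrite /insertion /=; case: ifP => [/andP[_ /eqP->]|_].
    by apply: RV; apply: trivial_flip; exact: (pos_hi_subproof j).
  by case: ifP => [/andP[_ /eqP->]|_] //; apply: trivial_flip; exact: (pos_lo_subproof j).
have -> : cls ((j, e) :: w) = cls [:: (j, e)] * cls w by rewrite clsM.
rewrite /= IHw braid_ofE; move: (cls [:: (j, e)]) => l.
exists (insertion (tracked w) (j, e) * (l * r * l^-1)).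
  by apply: RM => //; apply: trivial_normal.
by rewrite !mulgA mulgVK.
Qed.

(** Centrality is enough: the exponent of the twist is never computed. *)
Lemma flip_product_twist : D (dn x 0 n.-1).
Proof.
rewrite -center_pure_braid; last lia.
have [p1 pM pV] := @pure_subgroup n.-1.
split.
  have : forall k, (k <= n.-1)%N -> pure_braid (dn x 0 k).
    elim=> [|k IHk] kn //=; apply: pM; last by apply: IHk; lia.
    by apply: pure_flip_seq; lia.
  by apply.
move=> y _; apply: commute_gen => j jn; apply/commute_sym.
by apply: (artin_prod_commute sx); lia.
Qed.

Lemma track_flip p h : (p < n.-1)%N ->
  track (gen n.-1) x (flip n p) (n.-1, h) = (n.-1, h).
Proof.
(* For the flip at [n.-2] the sweep is empty, and the flip of $B_{n-1}$ cancels the one recorded by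
   the double crossing. The lower flips are its conjugates by letters that leave the tracked strand
   last. *)
have F k : (k < n.-1)%N ->
    forall h, track (gen n.-1) x (flip n (n.-2 - k)) (n.-1, h) = (n.-1, h).
  elim: k => [|k IHk] kn {}h.
    rewrite subn0; have jn : (n.-2 < n.-1)%N by lia.
    have := flip_sweep (gen_braid_seq n) jn.
    have -> : (n.-1 - n.-2.+1 = 0)%N by lia.
    rewrite /= mul1g mulg1 -flipE; last lia.
    rewrite -(iota_flip_seq jn) => ->.
    have nE : n.-2.+1 = n.-1 by lia.
    have lo := track_fun_lo n (gen n.-1) x n.-2 h.
    have hi := track_fun_hi n (gen n.-1) x n.-2 ((x n.-2)^-1 * h).
    rewrite nE in lo hi; rewrite !trackE // !track_genE // lo hi.
    by rewrite track_iota // braid_lift_gen mulVKg.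
  have -> : flip n (n.-2 - k.+1) = (g (n.-2 - k.+1))^-1 * flip n (n.-2 - k) * g (n.-2 - k.+1).
    have -> : (n.-2 - k = (n.-2 - k.+1).+1)%N by lia.
    rewrite (flipE (p := (n.-2 - k.+1).+1)) ?(flipE (p := n.-2 - k.+1)); try lia.
    by rewrite -mulgA -flip_seqS ?mulKg //; lia.
  have gt h' : track (gen n.-1) x (g (n.-2 - k.+1)) (n.-1, h') =
      (n.-1, gen n.-1 (n.-2 - k.+1) * h').
    by rewrite track_genE ?track_fun_gt //; lia.
  move: (flip n (n.-2 - k)) (IHk (ltnW kn)) => r fixr.
  rewrite !trackE // gt fixr.
  by rewrite trackV // -gt bfunVK.
move=> pn; have -> : p = (n.-2 - (n.-2 - p))%N by lia.
by apply: F; lia.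
Qed.

Lemma straighten_trivial b : R b -> D (straighten b).
Proof.
have [d1 dM dV] : subgroup D by exact: gen_subgroupP.
suff : R `<=` [set b | pure_braid b /\ D (straighten b)] by move=> H /H[].
have [p1 pM pV] := @pure_subgroup n.
have fD p : (p < n)%N -> D (straighten (flip n p)).
  move=> pn; have [pl|pl] := ltnP p n.-1.
    by rewrite /straighten /cocycle track_flip.
  have -> : p = n.-1 by lia.
  rewrite /straighten cocycle_flip_last //.
  by apply: dV; apply: flip_product_twist.
apply: gen_subgroup_min; last first.
  move=> _ [->|[p pn ->]]; split; [exact: pure_full_twist | | exact: pure_flip | exact: fD].
  rewrite (iota_full_twist n1) straightenM ?straighten_iota.
  - by apply: dM; [apply: gen_subgroup_in | apply: fD; lia].
  - by apply/pure_iota/pure_full_twist; lia.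
  - by apply: pure_flip; lia.
split=> [|a c [aP aD] [cP cD]|a [aP aD]].
- by split=> //; rewrite -(iota_braid1 n) straighten_iota.
- by split; [apply: pM | rewrite straightenM //; apply: dM].
- by split; [apply: pV | rewrite straightenV //; apply: dV].
Qed.

Lemma trivial_iota_twist c : D c -> R (iota_braid c).
Proof.
have [R1 RM RV] : subgroup R by exact: gen_subgroupP.
move: c; apply: gen_subgroup_min; last first.
  move=> _ ->; have -> : iota_braid (full_twist n.-1) = full_twist n * (flip n n.-1)^-1.
    by rewrite (iota_full_twist n1) mulgK.
  apply: (RM); [exact: trivial_full_twist | apply: (RV); apply: trivial_flip; lia].
split=> [|a b aR bR|a aR] /=; first by rewrite iota_braid1.
  by rewrite iota_braidM; apply: RM.
by rewrite iota_braidV; apply: RV.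
Qed.

Lemma pure_straighten b : pure_braid b -> pure_braid (straighten b).
Proof.
move=> bP; apply/pure_iota; rewrite -(cls_repr b) in bP *.
rewrite -s_braidE //; have [r /pure_trivial rP ->] := s_braid_trivial (generic_quotient.repr b).
by have [p1 pM pV] := @pure_subgroup n; apply: pM.
Qed.

Lemma trivialE b : pure_braid b -> R b <-> D (straighten b).
Proof.
move=> bP; split; first exact: straighten_trivial.
have [R1 RM RV] : subgroup R by exact: gen_subgroupP.
rewrite -(cls_repr b) in bP *; move: (generic_quotient.repr b) bP => w bP /trivial_iota_twist.
rewrite -s_braidE //; have [r Rr ->] := s_braid_trivial w => Rrw.
by rewrite -(mulKg r (cls w)); apply: RM => //; apply: RV.
Qed.

End Unplait.

(** * Cosets and the one-to-one correspondence *)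

Lemma lcoset_eq (G : groupType) (H : set G) (x y : G) : subgroup H ->
  lcoset_set x H = lcoset_set y H <-> H (x^-1 * y).
Proof.
move=> [H1 HM HV]; split=> [e|Hxy].
  have : lcoset_set y H y by exists 1; rewrite ?mulg1.
  by rewrite -e => -[h Hh <-]; rewrite mulKg.
apply/seteqP; split=> _ [h Hh <-].
  exists ((x^-1 * y)^-1 * h); first by apply: (HM) => //; apply: HV.
  by rewrite invMg invgK !mulgA mulgV mul1g.
exists (x^-1 * y * h); first exact: HM.
by rewrite !mulgA mulgV mul1g.
Qed.

Theorem proposition2 (n : nat) (hn : (2 <= n)%N) :
  (forall (b : braid n) (w : bword n), pure_braid b -> braid_of w = b ->
     (topologically_trivial b <->
      exists m : int, s_braid w = iota_braid (expgz (full_twist n.-1) m))) /\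
  (exists phi : set (braid n) -> set (braid n.-1),
     set_bij (quotient_set (@pure_braid n) (@trivial_subgroup n))
             (quotient_set (@pure_braid n.-1)
                (gen_subgroup (set1 (full_twist n.-1)))) phi /\
     (forall (b : braid n) (w : bword n), pure_braid b -> braid_of w = b ->
        (exists2 c : braid n.-1, pure_braid c & iota_braid c = s_braid w) /\
        (forall c : braid n.-1, pure_braid c -> iota_braid c = s_braid w ->
           phi (lcoset_set b (@trivial_subgroup n)) =
           lcoset_set c (gen_subgroup (set1 (full_twist n.-1)))))) /\
  center (@pure_braid n.-1) = gen_subgroup (set1 (full_twist n.-1)).
Proof.
set D := gen_subgroup (set1 (full_twist n.-1)).
have DS : subgroup D by exact: gen_subgroupP.
have RS : subgroup (@trivial_subgroup n) by exact: gen_subgroupP.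
have [R1 RM RV] := RS; have [p1 pM pV] := @pure_subgroup n.
split=> [b w bP|].
  rewrite braid_ofE => wb; subst b; rewrite s_braidE //.
  rewrite /topologically_trivial trivialE //.
  split=> [/gen_subgroup1P[m ->]|[m e]]; first by exists m.
  apply/gen_subgroup1P; exists m.
  by rewrite -[LHS](straighten_iota hn) e straighten_iota.
split; last by apply: center_pure_braid; lia.
(* Taking the union over all representatives avoids a choice; [phiE] shows that on cosets in
   $P_n/R_n$ this union is a single coset. *)
pose phi (S : set (braid n)) : set (braid n.-1) :=
  [set c | exists2 b, S b & lcoset_set (straighten b) D c].
have phiE b : pure_braid b ->
    phi (lcoset_set b (@trivial_subgroup n)) = lcoset_set (straighten b) D.
  move=> bP; apply/seteqP; split=> [c [_ [r Rr <-]]|c bc]; last first.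
    by exists b => //; exists 1; rewrite ?mulg1.
  have -> // : lcoset_set (straighten (b * r)) D = lcoset_set (straighten b) D.
  symmetry; apply/lcoset_eq => //; have rP := pure_trivial hn Rr.
  by rewrite straightenM // mulKg; apply: straighten_trivial.
exists phi; split.
  split.
  - move=> _ [b bP <-]; rewrite phiE //; exists (straighten b) => //.
    exact: pure_straighten.
  - move=> _ _ /set_mem[a aP <-] /set_mem[b bP <-]; rewrite !phiE // => /lcoset_eq e.
    apply/lcoset_eq => //; apply/trivialE => //; first by apply: pM => //; apply: pV.
    rewrite straightenM // ?straightenV //; last exact: pV.
    exact: e.
  - move=> _ [c cP <-]; have icP : pure_braid (iota_braid c : braid n) by apply/pure_iota.
    exists (lcoset_set (iota_braid c) (@trivial_subgroup n)); first by exists (iota_braid c).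
    by rewrite phiE // straighten_iota.
move=> b w bP; rewrite braid_ofE => wb; subst b; rewrite s_braidE //; split.
  by exists (straighten (cls w)) => //; apply: pure_straighten.
move=> c cP e; rewrite phiE //.
by rewrite -(straighten_iota hn c) e straighten_iota.
Qed.
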